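(* Let $v,w\in\mathfrak{S}_n$ with $v\le w$ in Bruhat order. If $Q_{v,w}$ is toric, then $Q_{v,w}$ and $Q_{v^{-1},w^{-1}}$ are combinatorially equivalent.
   Context: $\mathfrak{S}_n$ is the symmetric group on $\{1,\dots,n\}$, $\ell(\cdot)$ is the length with respect to the simple transpositions $s_i=(i,i+1)$, and $\le$ is Bruhat order (note $v\le w$ iff $v^{-1}\le w^{-1}$). For $v\le w$, the Bruhat interval polytope $Q_{v,w}$ is the convex hull in $\mathbb{R}^n$ of the points $(z(1),\dots,z(n))$ for $z\in\mathfrak{S}_n$ with $v\le z\le w$. $Q_{v,w}$ is called toric if $\dim Q_{v,w}=\ell(w)-\ell(v)$. Two polytopes are combinatorially equivalent if their face posets are isomorphic. *)

(* Defs.v *)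
From HB Require Import structures.
From mathcomp Require Import all_boot all_order all_algebra all_fingroup.
From mathcomp Require Import all_classical all_reals.

Set Implicit Arguments.
Unset Strict Implicit.
Unset Printing Implicit Defensive.

Import Order.TTheory GRing.Theory Num.Theory.

Local Open Scope classical_set_scope.
Local Open Scope ring_scope.

Definition simple_transpositions (n : nat) : {set 'S_n} :=
  [set s : 'S_n | [exists i : 'I_n, exists j : 'I_n,
     (nat_of_ord j == i.+1) && (s == tperm i j)]]%SET.

Lemma gen_simple_transpositions (n : nat) :
  <<simple_transpositions n>>%g = [set: 'S_n]%SET.
Proof.
have tpermS d (i j : 'I_n) : (j = i + d.+1 :> nat)%N ->
    (tperm i j \in <<simple_transpositions n>>)%g.
  elim: d j => [|d IHd] j ji.
    apply/mem_gen; rewrite inE; apply/existsP; exists i; apply/existsP.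
    by exists j; rewrite ji addn1 !eqxx.
  have kn : (i + d.+1 < n)%N by apply: leq_trans (ltn_ord j); rewrite ji !addnS ltnS.
  set k := Ordinal kn.
  have kj : (tperm k j \in <<simple_transpositions n>>)%g.
    apply/mem_gen; rewrite inE; apply/existsP; exists k; apply/existsP.
    by exists j; rewrite ji /= addnS !eqxx.
  have ik : k != i by rewrite -val_eqE /= -[X in _ == X]addn0 eqn_add2l.
  have ij : j != i by rewrite -val_eqE /= ji -[X in _ == X]addn0 eqn_add2l.
  have -> : (tperm i j = tperm i k ^ tperm k j)%g.
    by rewrite tpermJ tpermD // tpermL.
  by rewrite groupJ // IHd.
apply/setP => s; rewrite inE; case: (prod_tpermP s) => ts -> _.
apply: group_prod => -[i j] _ /=.
case: (ltngtP i j) => [lt_ij|lt_ji|/val_inj->]; last by rewrite tperm1 group1.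
  by apply: (tpermS (j - i).-1); rewrite prednK ?subn_gt0 // subnKC // ltnW.
by rewrite tpermC; apply: (tpermS (i - j).-1); rewrite prednK ?subn_gt0 // subnKC // ltnW.
Qed.

(* The pointwise power [S ^+ k] of a set of group elements is the set of
   products of [k] elements of [S]. *)
Lemma simple_word_exists (n : nat) (w : 'S_n) :
  exists k, (w \in simple_transpositions n ^+ k)%g.
Proof.
have : (w \in <<simple_transpositions n>>)%g.
  by rewrite gen_simple_transpositions inE.
case/gen_prodgP => k [c cS ->]; exists k.
elim: k c cS => [|k IHk] c cS; first by rewrite big_ord0 expg0 set11.
rewrite big_ord_recl expgS; apply: mem_mulg; first exact: cS.
by apply: IHk => i; apply: cS.
Qed.

Definition perm_length (n : nat) (w : 'S_n) : nat :=
  ex_minn (simple_word_exists w).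

(* Left and right multiplication by transpositions give the same relation,
   as [u * t = (u * t * u^-1) * u], so the order does not depend on the
   convention for composing permutations. *)
Definition bruhat_step (n : nat) : rel 'S_n := fun u w =>
  [exists i : 'I_n, exists j : 'I_n,
     (i != j) && (w == u * tperm i j)%g] && (perm_length u < perm_length w)%N.

Definition bruhat_le (n : nat) : rel 'S_n := connect (@bruhat_step n).

Section Polytopes.
Variable R : realType.

Definition affine_hull (V : lmodType R) (A : set V) : set V :=
  [set x | exists (k : nat) (a : 'I_k -> R) (p : 'I_k -> V),
     [/\ forall i, A (p i), \sum_(i < k) a i = 1
       & x = \sum_(i < k) a i *: p i]].

Definition convex_hull (V : lmodType R) (A : set V) : set V :=
  [set x | exists (k : nat) (a : 'I_k -> R) (p : 'I_k -> V),
     [/\ forall i, A (p i), forall i, 0 <= a i, \sum_(i < k) a i = 1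
       & x = \sum_(i < k) a i *: p i]].

(* The affine hull of [A] is a translate of a [d]-dimensional subspace; in
   particular the empty set has no dimension. *)
Definition has_affine_dim (V : vectType R) (A : set V) (d : nat) : Prop :=
  exists (x0 : V) (U : {vspace V}),
    affine_hull A = [set x | x - x0 \in U] /\ \dim U = d.

(* Both the empty face ([c = 0], [b = 1]) and [P] itself ([c = 0], [b = 0])
   are faces. *)
Definition faces (V : lmodType R) (P : set V) : set (set V) :=
  [set F | exists (c : {scalar V}) (b : R),
     (forall x, P x -> c x <= b) /\ F = P `&` [set x | c x = b]].

Definition combinatorially_equivalent (V W : lmodType R)
    (P : set V) (Q : set W) : Prop :=
  exists f : set V -> set W,
    set_bij (faces P) (faces Q) f /\
    (forall F G, faces P F -> faces P G -> (f F `<=` f G <-> F `<=` G)).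

(* ['I_n] is [{0, ..., n-1}], hence the shift to values in [{1, ..., n}]. *)
Definition perm_point (n : nat) (z : 'S_n) : 'rV[R]_n :=
  \row_(i < n) (z i).+1%:R.

Definition bruhat_interval_polytope (n : nat) (v w : 'S_n) : set 'rV[R]_n :=
  convex_hull (@perm_point n @` [set z | bruhat_le v z && bruhat_le z w]).

(* The truncated subtraction is exact when [bruhat_le v w]. *)
Definition toric (n : nat) (v w : 'S_n) : Prop :=
  has_affine_dim (bruhat_interval_polytope v w)
    (perm_length w - perm_length v)%N.

End Polytopes.

Arguments bruhat_interval_polytope R {n} v w _.

(* Main.v *)
(** For $v \le w$ let $[v,w]$ be toric. The transpositions along a maximal chain
    then form a forest, which amounts to: $\ell(w) - \ell(v)$ is the rank of the
    difference $P_v - P_w$ of permutation matrices. This criterion is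
    invariant under inversion (transpose), and it is inherited by all subintervals.
    So it suffices to show that under this rank condition the nonempty faces of
    $Q_{v,w}$ are exactly the $Q_{x,y}$ with $v \le x \le y \le w$; inversion is then an
    isomorphism of face posets.

    A flag in the open Richardson variety of $(v,w)$ has a Coxeter matroid
    $Y \subseteq [v,w]$ containing $v$ and $w$. Every face of $Y$ is again a Coxeter
    matroid, with a Bruhat minimum $x$ and maximum $y$. A linear form constant on $Y$
    is constant on $[v,w]$, so for a proper face $[x,y]$ is shorter than $[v,w]$ and, by
    induction, the face is all of $[x,y]$. In particular the facets of $Y$ are of the
    form $[a,w]$ with $a$ an atom or $[v,b]$ with $b$ a coatom; rotating a supporting
    hyperplane about the ridge $[a,b]$ moves from one to the other. Since open
    Bruhat intervals of length at least 3 are connected, all the $[a,w]$ and $[v,b]$ are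
    facets, whence $Y = [v,w]$. *)
From HB Require Import structures.
Require Import Defs.
From mathcomp Require Import all_classical all_reals.
From mathcomp Require Import all_boot all_order all_algebra all_fingroup.
From mathcomp Require Import zify ring lra.

Set Implicit Arguments.
Unset Strict Implicit.
Unset Printing Implicit Defensive.

Import Order.TTheory GRing.Theory Num.Theory.

Local Open Scope ring_scope.

(** * Bruhat order *)

Section Bruhat.
Variable n : nat.
Implicit Types (x y z u v w : 'S_n) (p q i j : 'I_n).
Local Open Scope nat_scope.

(** It is not known at the outset that $[v,w]$ is a Coxeter matroid. The induction therefore treats
    every Coxeter matroid between the endpoints and forces it to be the whole interval; the flag
    only guarantees that there is one.

    Rank replaces dimension because it is local. Always $\mathrm{rank}(P_x-P_y)\le\ell(y)-\ell(x)$,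
    and rank is subadditive where length is additive, so equality on $[v,w]$ passes to every piece.
    Dimension enters through a maximal chain: a form constant along one such chain is constant on
    the whole interval, so the directions of the affine hull lie in the span of the roots of the
    chain. Being toric makes these roots independent, and Carter's lemma translates independence
    into rank.

    Connectedness of open intervals is used twice, for this constancy and for spreading facets.
    Length 2 is the exception, since its open interval consists of incomparable elements: there
    constancy comes from the cycles of a product of two transpositions, and facets from rotating one
    edge about the vertex [v]. *)

Definition corank z m r := \sum_(i < n) ((i < r) && (z i < m)).

(* The tableau criterion: [corank] is largest for the identity. *)
Definition ble x y := [forall m : 'I_n.+1, forall r : 'I_n.+1, corank y m r <= corank x m r].

Definition ninv z := \sum_(i < n) \sum_(j < n) ((i < j) && (z j < z i)).

(* [pswap] exchanges the values at two positions, [vswap] (below) the positions of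
   two values; mathcomp composes permutations from left to right. *)
Definition pswap p q x : 'S_n := (tperm p q * x)%g.

Lemma corank_minn z m r : corank z m r = corank z (minn m n) (minn r n).
Proof.
by apply: eq_bigr => i _; rewrite !leq_min !ltn_ord !andbT.
Qed.

Lemma bleP x y : reflect (forall m r, corank y m r <= corank x m r) (ble x y).
Proof.
apply: (iffP forallP) => [H m r|H m]; last by apply/forallP.
rewrite corank_minn [in X in _ <= X]corank_minn.
have lt k : minn k n < n.+1 by rewrite ltnS geq_minr.
by have /forallP/(_ (Ordinal (lt r))) := H (Ordinal (lt m)).
Qed.

Lemma ble_refl x : ble x x. Proof. by apply/bleP. Qed.

Lemma ble_trans y x z : ble x y -> ble y z -> ble x z.
Proof. by move=> /bleP xy /bleP yz; apply/bleP => m r; apply: leq_trans (xy m r). Qed.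

Lemma sum_split2 (F : 'I_n -> nat) p q : p != q ->
  \sum_(i < n) F i = F p + F q + \sum_(i < n | (i != p) && (i != q)) F i.
Proof.
by move=> pq; rewrite (bigD1 p) //= (bigD1 q) /= ?addnA // eq_sym.
Qed.

Lemma pswapL p q x : pswap p q x p = x q. Proof. by rewrite permM tpermL. Qed.
Lemma pswapR p q x : pswap p q x q = x p. Proof. by rewrite permM tpermR. Qed.
Lemma pswapD p q x i : i != p -> i != q -> pswap p q x i = x i.
Proof. by move=> ip iq; rewrite permM tpermD // eq_sym. Qed.

Lemma corank_pswap x p q m r : p < q -> x p < x q ->
  corank (pswap p q x) m r + ((p < r <= q) && (x p < m <= x q)) = corank x m r.
Proof.
move=> pq xpq; have npq : p != q by rewrite -val_eqE /= neq_ltn pq.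
rewrite /corank !(sum_split2 _ npq) pswapL pswapR.
rewrite (eq_bigr (fun i => ((i < r) && (x i < m)) : nat)); last first.
  by move=> i /andP[ip iq]; rewrite pswapD.
set S := \sum_(i < n | _) _; lia.
Qed.

Lemma ble_pswap x p q : p < q -> x p < x q -> ble x (pswap p q x).
Proof. by move=> pq xpq; apply/bleP => m r; rewrite -(corank_pswap m r pq xpq) leq_addr. Qed.

Definition cover_at x p q :=
  [&& p < q, x p < x q & [forall i : 'I_n, (p < i < q) ==> ~~ (x p < x i < x q)]].

(** The pair [p], [q] becomes an inversion. Any other position [j] lies outside the empty rectangle
    between the two entries, so the inversions it forms with [p] and [q] keep their total number. *)
Lemma ninv_cover x p q : cover_at x p q -> ninv (pswap p q x) = (ninv x).+1.
Proof.
case/and3P => pq xpq /forallP nb.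
have npq : p != q by rewrite -val_eqE /= neq_ltn pq.
pose F y i j := (i < j) && (y j < y i).
have split y : ninv y = F y p q + F y q p
    + \sum_(j < n | (j != p) && (j != q)) (F y p j + F y q j)
    + (\sum_(j < n | (j != p) && (j != q)) (F y j p + F y j q)
    + \sum_(i < n | (i != p) && (i != q)) \sum_(j < n | (j != p) && (j != q)) F y i j).
  have e i : \sum_(j < n) ((i < j) && (y j < y i)) =
      F y i p + F y i q + \sum_(j < n | (j != p) && (j != q)) F y i j.
    exact: sum_split2.
  rewrite /ninv (sum_split2 _ npq) !e (eq_bigr _ (fun i _ => e i)) !big_split /= /F; lia.
rewrite !split.
have -> : \sum_(i < n | (i != p) && (i != q)) \sum_(j < n | (j != p) &&
  (j != q)) F (pswap p q x) i j
  = \sum_(i < n | (i != p) && (i != q)) \sum_(j < n | (j != p) && (j != q)) F x i j.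
  by apply: eq_bigr => i /andP[ip iq]; apply: eq_bigr => j /andP[jp jq]; rewrite /F !pswapD.
have row : \sum_(j < n | (j != p) && (j != q)) (F (pswap p q x) p j + F (pswap p q x) q j)
   + \sum_(j < n | (j != p) && (j != q)) (F (pswap p q x) j p + F (pswap p q x) j q)
   = \sum_(j < n | (j != p) && (j != q)) (F x p j + F x q j)
   + \sum_(j < n | (j != p) && (j != q)) (F x j p + F x j q).
  rewrite -!big_split /=; apply: eq_bigr => j /andP[jp jq].
  have nbj : p < j -> j < q -> x p < x j -> x j < x q -> False.
    by move=> a b c d; move: (nb j); rewrite a b c d.
  rewrite /F pswapL pswapR !pswapD //.
  have : x j != x p by rewrite (inj_eq perm_inj).
  have : x j != x q by rewrite (inj_eq perm_inj).
  move: jp jq pq xpq nbj; rewrite -!val_eqE /=.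
  move: (x p : nat) (x q : nat) (x j : nat) (p : nat) (q : nat) (j : nat) => a b c d e f.
  case: (ltngtP f d) => //; case: (ltngtP f e) => //; case: (ltngtP c a) => //;
  by case: (ltngtP c b) => //=; lia.
have -> : F (pswap p q x) p q = true by rewrite /F pswapL pswapR pq xpq.
have -> : F (pswap p q x) q p = false by rewrite /F ltnNge (ltnW pq).
have -> : F x p q = false by rewrite /F [x q < _]ltnNge (ltnW xpq) andbF.
have -> : F x q p = false by rewrite /F ltnNge (ltnW pq).
by rewrite !addnA !add0n -!addnA add1n; congr _.+1; rewrite !addnA row.
Qed.

Lemma corank_split z m r i0 : (i0 : nat) < r ->
  corank z m r = corank z m i0 + (z i0 < m) + \sum_(i < n) ((i0 < i < r) && (z i < m)).
Proof.
move=> i0r; rewrite /corank (bigD1 i0) //= i0r /=.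
rewrite [in RHS](bigD1 i0) //= ltnn /= add0n.
rewrite [X in _ = _ + _ + X](bigD1 i0) //= ltnn /= add0n addnC -[RHS]addnA addnCA addnC.
congr (_ + _); rewrite -big_split /=; apply: eq_bigr => i ii0.
by move: ii0; rewrite -val_eqE /=; lia.
Qed.

(* [p] is the first position where [x] and [y] differ, and [q] the next one whose
   value lies in $(x_p, y_p]$. *)
Lemma ble_exchange x y : ble x y -> x != y ->
  exists p q, cover_at x p q /\ ble (pswap p q x) y.
Proof.
move=> /bleP xy nxy.
have [i xyi] : exists i, x i != y i.
  by apply/existsP; apply: contraR nxy => /existsPn H; apply/eqP/permP => i; apply/eqP/negPn/H.
case: (@arg_minnP _ i (fun i => x i != y i) (@nat_of_ord n) xyi) => {xyi}i xyi imin.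
have same j : j < i -> x j = y j.
  by move=> ji; apply/eqP; apply: contraLR ji => /imin; rewrite -leqNgt.
have samec m : corank x m i = corank y m i.
  by apply: eq_bigr => j _; case: ltnP => //= /same ->.
have lt_xy : x i < y i.
  have z0 z m : \sum_(j < n) ((i < j < i.+1) && (z j < m)) = 0.
    by rewrite big1 // => j _; case: ltnP => // ij; rewrite ltnS leqNgt ij.
  have := xy (y i).+1 i.+1; rewrite !(corank_split _ _ (ltnSn i)) samec !z0 !addn0.
  rewrite leq_add2l ltnSn lt0b ltnS => le_xy.
  by rewrite ltn_neqAle le_xy andbT.
pose Q j := (i < j) && (x i < x j <= y i).
have [j0 Qj0] : exists j, Q j.
  exists (x^-1 (y i))%g; rewrite /Q permKV lt_xy leqnn !andbT.
  rewrite ltn_neqAle; apply/andP; split.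
    by apply/eqP => /val_inj e; move: lt_xy; rewrite [in x i]e permKV ltnn.
  rewrite leqNgt; apply/negP => lt; have := same _ lt; rewrite permKV => /perm_inj e.
  by move: lt; rewrite -e ltnn.
case: (@arg_minnP _ j0 Q (@nat_of_ord n) Qj0) => q /andP[iq /andP[xiq xqy]] qmin.
have cov : cover_at x i q.
  rewrite /cover_at iq xiq /=; apply/forallP => j; apply/implyP => /andP[ij jq].
  apply/negP => /andP[a b]; have := qmin j; rewrite /Q ij a /= (leq_trans (ltnW b) xqy).
  by move=> /(_ isT); rewrite leqNgt jq.
exists i, q; split => //; apply/bleP => m r.
have := corank_pswap m r iq xiq; case: (boolP (_ && _)) => [|_]; last by rewrite addn0 => ->;
  exact: xy.
move=> /andP[/andP[ir rq] /andP[xim mxq]] e.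
(* Inside the rectangle the inequality must be strict. Compare at the bound $y_i+1$: by minimality
   of [q], between [i] and [r] no entry of [x] lies in $[m,y_i]$, so there [x] has as many entries
   below $m$ as below $y_i+1$. At bound [m], position [i] counts for [x] but not for [y]. *)
suff : corank y m r < corank x m r by rewrite -e addn1 ltnS.
have := xy (y i).+1 r; rewrite !(corank_split _ _ ir) !samec xim.
rewrite leqnn (_ : x i < (y i).+1); last by rewrite ltnS ltnW.
rewrite leq_add2l (_ : y i < m = false) ?addn0 ?addn1; last first.
  by apply/negbTE; rewrite -leqNgt (leq_trans mxq).
move=> H; rewrite addSn ltnS leq_add2l.
apply: leq_trans (leq_trans H _); apply: leq_sum => j _.
  have h : y j < m -> y j < (y i).+1 by move=> h;
    rewrite ltnS (leq_trans (ltnW h)) // (leq_trans mxq).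
  by case: (_ < _ < _) => //=; case: (ltnP (y j) m) => // /h ->.
case: (ltnP i j) => //= ij; case: (ltnP j r) => //= jr.
case: (ltnP (x j) (y i).+1) => //= xj; rewrite lt0b ltnNge; apply/negP => mj.
have := qmin j; rewrite /Q ij (leq_trans xim mj) -ltnS xj => /(_ isT).
by rewrite leqNgt (leq_trans jr rq).
Qed.
End Bruhat.

(** * Grading, simple transpositions and the lifting property *)

Section Bruhat2.
Variable n : nat.
Implicit Types (x y z u v w : 'S_n) (p q i j k : 'I_n).
Local Open Scope nat_scope.

Lemma pswapK p q x : pswap p q (pswap p q x) = x.
Proof. by rewrite /pswap mulgA tperm2 mul1g. Qed.

Lemma ninv_le z : ninv z <= n * n.
Proof.
have h : \sum_(i < n) \sum_(j < n) 1 = n * n by rewrite !sum_nat_const !card_ord muln1.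
by rewrite -h; apply: leq_sum => i _; apply: leq_sum => j _; case: (_ && _).
Qed.

(** Exchanges form a chain of covers from [x] up to [y], and [P] is carried down along it. *)
Lemma ble_ind y (P : 'S_n -> Prop) : P y ->
  (forall x p q, cover_at x p q -> ble (pswap p q x) y -> P (pswap p q x) -> P x) ->
  forall x, ble x y -> P x.
Proof.
move=> Py Pstep x; have [d] := ubnP (n * n - ninv x).
elim: d x => // d IH x; rewrite ltnS => hd xy.
case: (altP (x =P y)) => [-> //|nxy].
have [p [q [cov xy']]] := ble_exchange xy nxy.
apply: (Pstep _ _ _ cov xy'); apply: IH xy'.
by have := ninv_le (pswap p q x); rewrite (ninv_cover cov); lia.
Qed.

Lemma cover_ble x p q : cover_at x p q -> ble x (pswap p q x).
Proof. by case/and3P => pq xpq _; exact: ble_pswap. Qed.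

Lemma ble_ninv x y : ble x y -> ninv x <= ninv y.
Proof.
move: x; apply: ble_ind => // x p q cov _; rewrite (ninv_cover cov); exact: ltnW.
Qed.

Lemma ble_ninv_lt x y : ble x y -> x != y -> ninv x < ninv y.
Proof.
move=> xy nxy; have [p [q [cov /ble_ninv]]] := ble_exchange xy nxy.
by rewrite (ninv_cover cov).
Qed.

Lemma ble_ninv_eq x y : ble x y -> ninv y <= ninv x -> x = y.
Proof.
by move=> xy le; apply/eqP; apply: contraLR le => /(ble_ninv_lt xy); rewrite -ltnNge.
Qed.

Lemma ble_anti x y : ble x y -> ble y x -> x = y.
Proof. by move=> xy /ble_ninv; exact: ble_ninv_eq. Qed.

Lemma ble_atom x y : ble x y -> x != y ->
  exists z, [/\ ble x z, ble z y & ninv z = (ninv x).+1].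
Proof.
move=> xy nxy; have [p [q [cov le]]] := ble_exchange xy nxy.
by exists (pswap p q x); split => //; [exact: cover_ble | exact: ninv_cover].
Qed.

(** The exchange lemma only climbs from below, so a coatom is reached as the last element before [y]
    on a chain of atoms. *)
Lemma ble_coatom x y : ble x y -> x != y ->
  exists z, [/\ ble x z, ble z y & (ninv z).+1 = ninv y].
Proof.
have [d] := ubnP (ninv y - ninv x); elim: d x => // d IH x; rewrite ltnS => hd xy nxy.
have [z [xz zy nz]] := ble_atom xy nxy.
case: (altP (z =P y)) => [e|nzy].
  by exists x; split => //; [exact: ble_refl | rewrite -nz e].
have lt := ble_ninv_lt zy nzy.
have [|t [zt ty nt]] := IH z _ zy nzy; first by lia.
by exists t; split => //; apply: ble_trans zt.
Qed.

Lemma ble_cover x y : ble x y -> ninv y = (ninv x).+1 ->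
  exists p q, cover_at x p q /\ y = pswap p q x.
Proof.
move=> xy e; have nxy : x != y by apply/eqP => h; move: e; rewrite h; lia.
have [p [q [cov le]]] := ble_exchange xy nxy.
by exists p, q; split => //; apply/esym/(ble_ninv_eq le); rewrite e (ninv_cover cov).
Qed.

Definition vswap k k' x : 'S_n := (x * tperm k k')%g.

Lemma vswapE x k k' : (vswap k k' x) = pswap (x^-1 k)%g (x^-1 k')%g x.
Proof.
apply/permP => i; rewrite /vswap permM /pswap permM.
case: (altP (i =P (x^-1 k)%g)) => [->|ik]; first by rewrite tpermL !permKV tpermL.
case: (altP (i =P (x^-1 k')%g)) => [->|ik']; first by rewrite tpermR !permKV tpermR.
by rewrite !tpermD // 1?eq_sym // -[_ == _](inj_eq (@perm_inj _ x^-1)) permK.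
Qed.

Definition asc x k k' := (x^-1 k)%g < (x^-1 k')%g.

Lemma asc_vswap x k k' : asc (vswap k k' x) k k' = asc x k' k.
Proof. by rewrite /asc /vswap invMg tpermV !permM tpermL tpermR. Qed.

Lemma vswapK x k k' : vswap k k' (vswap k k' x) = x.
Proof. by rewrite /vswap -mulgA tperm2 mulg1. Qed.

Lemma vswap_inj k k' : injective (vswap k k').
Proof. by move=> x y; exact: mulIg. Qed.

Lemma ascN x k k' : k != k' -> ~~ asc x k k' = asc x k' k.
Proof.
move=> kk'; rewrite /asc -leqNgt leq_eqVlt.
by rewrite (_ : (_ == _) = false) //; apply/negbTE;
  rewrite (inj_eq val_inj) (inj_eq perm_inj) eq_sym.
Qed.

Section Simple.
Variables (k k' : 'I_n) (kk' : k' = k.+1 :> nat).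

Let nkk' : k != k'. Proof. by rewrite -val_eqE /= kk' neq_ltn ltnSn. Qed.

Let nkk'n : k != k' :> nat. Proof. exact: nkk'. Qed.

Lemma asc_cover x : asc x k k' -> cover_at x (x^-1 k)%g (x^-1 k')%g.
Proof.
move=> a; apply/and3P; split; rewrite ?permKV ?kk' //.
apply/forallP => i; apply/implyP => _; rewrite ltnS; lia.
Qed.

Lemma asc_ninv x : asc x k k' -> ninv (vswap k k' x) = (ninv x).+1.
Proof. by move=> a; rewrite vswapE ninv_cover ?asc_cover. Qed.

Lemma desc_ninv x : ~~ asc x k k' -> (ninv (vswap k k' x)).+1 = ninv x.
Proof.
by move=> a; rewrite -asc_ninv ?vswapK // asc_vswap -ascN.
Qed.

(* The larger and the smaller of [x] and [x * s], where [s] exchanges the values [k]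
   and [k + 1]. Their corank matrices are a maximum and a minimum of entries not
   affected by [s], so both maps are monotone: this is the lifting property. *)
Definition vswap_up x := if asc x k k' then (vswap k k' x) else x.
Definition vswap_down x := if asc x k k' then x else (vswap k k' x).

Lemma corankS x m i r : m = x i -> corank x m.+1 r = corank x m r + (i < r).
Proof.
move=> ->; rewrite /corank (bigD1 i) //= [in RHS](bigD1 i) //= ltnSn ltnn andbF andbT add0n addnC.
congr (_ + _); apply: eq_bigr => j ji; rewrite ltnS [x j <= _]leq_eqVlt.
by rewrite (_ : (x j == x i :> nat) = false) //; apply/negbTE;
  rewrite (inj_eq val_inj) (inj_eq perm_inj).
Qed.

Lemma corank_vswap x m r : m != k' :> nat -> corank (vswap k k' x) m r = corank x m r.
Proof.
move=> mk'; rewrite /corank; apply: eq_bigr => i _; rewrite /vswap permM;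
  congr (nat_of_bool (_ && _)).
move: mk'; rewrite kk' => mk'; have e : (k < m) = (k.+1 < m) by rewrite [RHS]ltn_neqAle eq_sym mk'.
by case: tpermP => [->|->|//]; rewrite kk' e.
Qed.

Lemma corank_k1 x r : corank x k' r = corank x k r + ((x^-1 k)%g < r).
Proof. by rewrite kk'; apply: corankS; rewrite permKV. Qed.

Lemma corank_k2 x r : corank x k'.+1 r = corank x k r + ((x^-1 k)%g < r) + ((x^-1 k')%g < r).
Proof. by rewrite -corank_k1; apply: corankS; rewrite permKV. Qed.

(** Of two positions the later one enters the count last, so it contributes only when both do;
    dually for the earlier one below. *)
Let max_ltn A p p' r : p <= p' -> A + (p' < r) = maxn A (A + (p < r) + (p' < r)).-1.
Proof. by case: (ltnP p r) => h; case: (ltnP p' r) => h' a; lia. Qed.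

Let min_ltn A p p' r : p <= p' -> A + (p < r) = minn A.+1 (A + (p < r) + (p' < r)).
Proof. by case: (ltnP p r) => h; case: (ltnP p' r) => h' a; lia. Qed.

Lemma corank_up x r : corank (vswap_up x) k' r = maxn (corank x k r) (corank x k'.+1 r).-1.
Proof.
rewrite corank_k2 /vswap_up /asc; case: ltnP => a; rewrite corank_k1;
  last by rewrite [in RHS]addnAC; exact: max_ltn.
by rewrite corank_vswap // /vswap invMg tpermV permM tpermL; apply/max_ltn/ltnW.
Qed.

Lemma corank_down x r : corank (vswap_down x) k' r = minn (corank x k r).+1 (corank x k'.+1 r).
Proof.
rewrite corank_k2 /vswap_down /asc; case: ltnP => a; rewrite corank_k1; first exact/min_ltn/ltnW.
by rewrite corank_vswap // /vswap invMg tpermV permM tpermL [in RHS]addnAC; exact: min_ltn.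
Qed.

Lemma ble_up x y : ble x y -> ble (vswap_up x) (vswap_up y).
Proof.
move=> /bleP xy; apply/bleP => m r; case: (altP (m =P k' :> nat)) => [->|mk'].
  by rewrite !corank_up; have := xy k r; have := xy k'.+1 r; lia.
by rewrite /vswap_up; do 2!case: ifP => _; rewrite ?corank_vswap.
Qed.

Lemma ble_down x y : ble x y -> ble (vswap_down x) (vswap_down y).
Proof.
move=> /bleP xy; apply/bleP => m r; case: (altP (m =P k' :> nat)) => [->|mk'].
  by rewrite !corank_down; have := xy k r; have := xy k'.+1 r; lia.
by rewrite /vswap_down; do 2!case: ifP => _; rewrite ?corank_vswap.
Qed.

Lemma asc_ble x : asc x k k' -> ble x (vswap k k' x).
Proof. by move=> a; rewrite vswapE; apply/cover_ble/asc_cover. Qed.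

Lemma le_up x : ble x (vswap_up x).
Proof. by rewrite /vswap_up; case: ifP => [/asc_ble//|_]; exact: ble_refl. Qed.

Lemma le_down x : ble (vswap_down x) x.
Proof.
rewrite /vswap_down; case: ifP => a; first exact: ble_refl.
by rewrite -{2}(vswapK x k k'); apply: asc_ble; rewrite asc_vswap -ascN // a.
Qed.

End Simple.

Lemma simpleP (s : 'S_n) :
  reflect (exists k k', k' = k.+1 :> nat /\ s = tperm k k') (s \in simple_transpositions n).
Proof.
rewrite inE; apply: (iffP existsP) => [[k /existsP[k' /andP[/eqP e /eqP ->]]]|[k [k' [e ->]]]].
  by exists k, k'.
by exists k; apply/existsP; exists k'; rewrite e !eqxx.
Qed.

(** Without a descent $x^{-1}$ is increasing, hence the identity. *)
Lemma exists_desc x : x != 1%g -> exists k k', k' = k.+1 :> nat /\ ~~ asc x k k'.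
Proof.
move=> x1; suff : ~~ [forall k : 'I_n, forall k' : 'I_n, (k' == k.+1 :> nat) ==> asc x k k'].
  case/forallPn => k /forallPn[k']; rewrite negb_imply => /andP[/eqP e a].
  by exists k, k'.
apply: contra x1 => /forallP H.
have S k k' : k' = k.+1 :> nat -> (x^-1 k)%g < (x^-1 k')%g.
  by move=> e; have /forallP/(_ k') := H k; rewrite e eqxx.
have ge m (hm : m < n) : m <= (x^-1 (Ordinal hm))%g.
  elim: m hm => // m IH hm; apply: leq_ltn_trans (IH (ltnW hm)) _; exact: S.
suff e i : (x^-1)%g i = i by apply/eqP; rewrite -[x]invgK -invg1; congr _^-1%g; apply/permP => i;
  rewrite perm1.
have [d] := ubnP (n - i); elim: d i => // d IH i; rewrite ltnS => hd.
apply/eqP; have := ge i (ltn_ord i); rewrite (_ : Ordinal _ = i); last exact: val_inj.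
rewrite leq_eqVlt => /orP[/eqP/val_inj/esym/eqP //|lt].
have := IH ((x^-1)%g i); rewrite (_ : _ < d) => [/(_ isT)/perm_inj e|].
  by rewrite e.
by have := ltn_ord (x^-1 i)%g; lia.
Qed.

Lemma ninv1 : ninv (1%g : 'S_n) = 0.
Proof.
rewrite /ninv big1 // => i _; rewrite big1 // => j _; rewrite !perm1.
by case: ltngtP.
Qed.

(** Removing a descent removes one letter and one inversion; conversely a letter adds at most one
    inversion. *)
Lemma perm_lengthE x : perm_length x = ninv x.
Proof.
rewrite /perm_length; case: ex_minnP => m xm mmin; apply/eqP; rewrite eqn_leq; apply/andP; split.
  apply: mmin; have [d] := ubnP (ninv x); elim: d x {m xm} => // d IH x; rewrite ltnS => hd.
  case: (altP (x =P 1%g)) => [->|x1]; first by rewrite ninv1 expg0 set11.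
  have [k [k' [e a]]] := exists_desc x1; have l := desc_ninv e a.
  rewrite -l expgSr; apply/mulsgP; exists (vswap k k' x) (tperm k k').
  - by apply: IH; lia.
  - by apply/simpleP; exists k, k'.
  - by rewrite -/(vswap k k' _) vswapK.
elim: m x xm {mmin} => [|m IH] x; first by rewrite expg0 => /set1P ->; rewrite ninv1.
rewrite expgSr => /mulsgP[u s um /simpleP[k [k' [e ->]]] ->].
have := IH u um; case: (boolP (asc u k k')) => a.
  by rewrite -/(vswap k k' u) (asc_ninv e a).
rewrite -/(vswap k k' u) => h; apply: leq_trans (leq_trans _ h) (leqnSn _).
by rewrite -(desc_ninv e a) leqnSn.
Qed.

(** A step exchanges two values, and the growth of the length decides which way the two entries are
    ordered. Conversely, the covers of an exchange chain are such steps. *)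
Lemma bruhat_leE x y : bruhat_le x y = ble x y.
Proof.
apply/idP/idP.
  case/connectP => p; elim: p x => [|z p IH] x /=; first by move=> _ ->; exact: ble_refl.
  move=> /andP[xz zp] /(IH _ zp); apply: ble_trans.
  move: xz; rewrite /bruhat_step !perm_lengthE => /andP[/existsP[i /existsP[j /andP[ij /eqP ->]]]].
  rewrite -/(vswap i j x) vswapE; set p' := (x^-1 i)%g; set q := (x^-1 j)%g => lt.
  have npq : p' != q by rewrite (inj_eq perm_inj).
  wlog pq : p' q lt npq / p' < q => [H|].
    move: (npq); rewrite neq_ltn => /orP[|qp]; first exact: H.
    by rewrite /pswap tpermC; apply: H; rewrite // 1?eq_sym // /pswap tpermC.
  case: (ltngtP (x p') (x q)) => [xpq|xqp|/val_inj/perm_inj e].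
  - exact: ble_pswap.
  - have h : ble (pswap p' q x) x.
      by have := @ble_pswap _ (pswap p' q x) p' q pq; rewrite pswapK pswapL pswapR; apply.
    by move: lt; rewrite ltnNge (ble_ninv h).
  - by rewrite e eqxx in npq.
move: x; apply: ble_ind => [|x p q cov _]; first exact: connect0.
apply: connect_trans; apply: connect1;
  rewrite /bruhat_step !perm_lengthE (ninv_cover cov) ltnSn andbT.
case/and3P: cov => pq _ _; apply/existsP; exists (x p); apply/existsP; exists (x q).
rewrite (inj_eq perm_inj) -/(vswap (x p) (x q) x) vswapE !permK eqxx andbT -val_eqE /=; lia.
Qed.

End Bruhat2.

Ltac nlia := repeat match goal with H : context[ninv ?x] |- _ => revert H end;
  repeat (let m := fresh in match goal with |- context[ninv ?x] => generalize (ninv x) as m end);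
  clear; intros; lia.

(** * Inversion and connectedness of open intervals *)

Section Bruhat3.
Variable n : nat.
Implicit Types (p x y z u v w : 'S_n) (i j k : 'I_n).
Local Open Scope nat_scope.

Lemma corank_inv z m r : corank z^-1%g m r = corank z r m.
Proof.
rewrite /corank (reindex_inj (@perm_inj _ z)).
by apply: eq_bigr => i _; rewrite permK andbC.
Qed.

Lemma ble_inv x y : ble x^-1%g y^-1%g = ble x y.
Proof. by apply/bleP/bleP => H m r; have := H r m; rewrite !corank_inv. Qed.

Lemma ninv_inv z : ninv z^-1%g = ninv z.
Proof.
rewrite /ninv (reindex_inj (@perm_inj _ z)) /= exchange_big /= (reindex_inj (@perm_inj _ z)) /=.
by apply: eq_bigr => i _; apply: eq_bigr => j _; rewrite !permK andbC.
Qed.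

Definition open_itv v w z := [&& ble v z, ble z w, z != v & z != w].

Lemma open_itv_ninv v w z : open_itv v w z -> ninv v < ninv z < ninv w.
Proof.
by case/and4P => vz zw zv zw'; rewrite !ble_ninv_lt // eq_sym.
Qed.

Lemma open_itvI v w z : ble v z -> ble z w -> ninv v < ninv z < ninv w -> open_itv v w z.
Proof.
move=> vz zw /andP[a b]; apply/and4P; split => //.
  by apply: contraTneq a => ->; rewrite ltnn.
by apply: contraTneq b => ->; rewrite ltnn.
Qed.

Section Descent.
Variables (k k' : 'I_n) (kk' : k' = k.+1 :> nat) (v w : 'S_n).
Hypotheses (vw : ble v w) (dw : ~~ asc w k k').
Local Notation vs := (vswap k k').
Local Notation up := (vswap_up k k').
Local Notation down := (vswap_down k k').

Lemma upD x : ~~ asc x k k' -> up x = x. Proof. by rewrite /vswap_up => /negbTE ->. Qed.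
Lemma upA x : asc x k k' -> up x = (vs x). Proof. by rewrite /vswap_up => ->. Qed.
Lemma downD x : ~~ asc x k k' -> down x = (vs x). Proof. by rewrite /vswap_down => /negbTE ->. Qed.
Lemma downA x : asc x k k' -> down x = x. Proof. by rewrite /vswap_down => ->. Qed.
Lemma asc_s x : asc (vs x) k k' = ~~ asc x k k'.
Proof. by rewrite asc_vswap -ascN // -val_eqE /= kk' neq_ltn ltnSn. Qed.

Lemma le_ws x : ble x w -> asc x k k' -> ble x (vs w).
Proof. by move=> /(ble_down kk'); rewrite (downD dw) => h a; rewrite downA in h. Qed.

Lemma up_le x : ble x w -> ble (up x) w.
Proof. by move=> /(ble_up kk'); rewrite (upD dw). Qed.

Lemma ws_le : ble (vs w) w.
Proof. by rewrite -(downD dw); exact: le_down. Qed.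

Lemma ninv_ws : (ninv (vs w)).+1 = ninv w. Proof. exact: desc_ninv. Qed.

Section Ascending.
Hypothesis av : asc v k k'.

Lemma vs_le x : ble v x -> ~~ asc x k k' -> ble (vs v) x.
Proof. by move=> /(ble_up kk'); rewrite (upA av) => h a; rewrite upD in h. Qed.

Lemma v_vs : ble v (vs v). Proof. by rewrite -(upA av); exact: le_up. Qed.

Lemma open_vs : ninv v + 2 <= ninv w -> open_itv v w (vs v).
Proof.
move=> h; apply: open_itvI; [exact: v_vs | exact: vs_le | rewrite (asc_ninv kk' av); nlia].
Qed.

Lemma open_ws : ninv v + 2 <= ninv w -> open_itv v w (vs w).
Proof.
move=> h; apply: open_itvI; [exact: le_ws | exact: ws_le |]; have := ninv_ws; nlia.
Qed.
End Ascending.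

Section Descending.
Hypothesis dv : ~~ asc v k k'.

(* When [s] is a descent of both ends, this maps the open interval $(v,w)$ to
   $(vs,ws)$; the elements with an ascent all lie below [w s] and collapse to [v]. *)
Definition fold_desc z := if asc z k k' then v else (vs z).

Lemma vs_v : ble (vs v) v. Proof. by rewrite -(downD dv); exact: le_down. Qed.

Lemma ninv_vs : (ninv (vs v)).+1 = ninv v. Proof. exact: desc_ninv. Qed.

Lemma fold_open z : ninv v + 2 <= ninv w ->
  open_itv v w z -> open_itv (vs v) (vs w) (fold_desc z).
Proof.
move=> h oz; have /andP[n1 n2] := open_itv_ninv oz; case/and4P: oz => vz zw _ _.
have := ninv_ws; have := ninv_vs; rewrite /fold_desc; case: ifP => a e1 e2.
  apply: open_itvI; [exact: vs_v | exact: ble_trans (le_ws zw a) | nlia].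
have ez := desc_ninv kk' (negbT a); rewrite -(downD (negbT a)) -(downD dv) -(downD dw).
apply: open_itvI; [exact: ble_down | exact: ble_down |].
rewrite !downD ?a //; nlia.
Qed.

Lemma up_open p : open_itv (vs v) (vs w) p -> p != v -> open_itv v w (up p).
Proof.
move=> op pv; case/and4P: op => vp pw nv nw.
have ev : up (vs v) = v by rewrite upA ?vswapK // asc_s.
have ew : up (vs w) = w by rewrite upA ?vswapK // asc_s.
apply/and4P; split; [by rewrite -{1}ev; exact: ble_up | by rewrite -[w in ble _ w]ew;
  exact: ble_up | |].
  rewrite /vswap_up; case: ifP => // _.
  by rewrite -(inj_eq (@vswap_inj n k k')) vswapK.
rewrite /vswap_up; case: ifP => [_|_]; first by rewrite -(inj_eq (@vswap_inj n k k')) vswapK.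
apply/eqP => e; have := ble_ninv pw; rewrite e -ninv_ws; nlia.
Qed.

(** [v] may itself belong to the open interval $(vs,ws)$, but [up v] is [v], which is not in
    $(v,w)$. The value of [Q'] there is taken at $ws$: the elements that collapse to [v] all lie
    below $ws$, so [Q] agrees on them with [Q (vs w)]. *)
Lemma fold_transfer (Q : 'S_n -> Prop) : ninv v + 2 <= ninv w ->
  (forall x y, open_itv v w x -> open_itv v w y -> ble x y -> (Q x <-> Q y)) ->
  let Q' p := if p == v then Q (vs w) else Q (up p) in
  (forall x y, open_itv (vs v) (vs w) x -> open_itv (vs v) (vs w) y ->
     ble x y -> (Q' x <-> Q' y)) /\
  (forall z, open_itv v w z -> (Q z <-> Q' (fold_desc z))).
Proof.
move=> h QQ Q'; have ews := ninv_ws; have evs := ninv_vs; split.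
  move=> x y ox oy xy; rewrite /Q'; case: (altP (x =P v)) => [xv|xv];
    case: (altP (y =P v)) => [yv|yv].
  - by [].
  - have vy : ble v y by rewrite -xv.
    have yws : ble y (vs w) by case/and4P: oy.
    have yw : ble y w by apply: ble_trans ws_le.
    have n1 : ninv v < ninv y by apply: ble_ninv_lt => //; rewrite eq_sym.
    have n2 := ble_ninv yws.
    have oy' : open_itv v w y by apply: open_itvI => //; nlia.
    have ow : open_itv v w (vs w) by apply: open_itvI; [exact: ble_trans yws | exact: ws_le | nlia].
    by rewrite -(QQ _ _ oy' ow yws); apply: QQ => //; [exact: up_open | exact: le_up].
  - have /andP[n1 _] := open_itv_ninv ox.
    by have := ble_ninv_lt xy; rewrite yv => /(_ xv) n2; nlia.
  - by apply: QQ; [exact: up_open | exact: up_open | exact: ble_up].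
move=> z oz; rewrite /Q' /fold_desc; case: (boolP (asc z k k')) => a.
  rewrite eqxx; have /andP[n1 n2] := open_itv_ninv oz.
  case/and4P: (oz) => vz zw _ _; have zws := le_ws zw a.
  apply: QQ => //; apply: open_itvI; [exact: ble_trans zws | exact: ws_le | nlia].
have -> : ((vs z) == v) = false.
  by apply/negbTE; apply: contraNneq dv => <-; rewrite asc_s.
by rewrite upA ?asc_s // vswapK.
Qed.

End Descending.
End Descent.

(** Connectedness, phrased for properties constant along comparable pairs. Take a descent [s] of
    [w]. If it is an ascent of [v], the elements with a descent lie above $vs$ and those with an
    ascent below $ws$, and the two groups must be joined. If it is a descent at both ends,
    [fold_desc] leads to $(vs,ws)$, whose upper end is shorter. *)
Lemma open_itv_conn v w (Q : 'S_n -> Prop) : ble v w -> ninv v + 3 <= ninv w ->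
  (forall x y, open_itv v w x -> open_itv v w y -> ble x y -> (Q x <-> Q y)) ->
  forall x y, open_itv v w x -> open_itv v w y -> (Q x <-> Q y).
Proof.
have [d] := ubnP (ninv w); elim: d v w Q => // d IH v w Q; rewrite ltnS => hd vw h QQ.
have w1 : w != 1%g by apply/eqP => e; move: h; rewrite e ninv1; nlia.
have [k [k' [kk' dw]]] := exists_desc w1; have ews := ninv_ws kk' dw.
have h2 : ninv v + 2 <= ninv w by nlia.
case: (boolP (asc v k k')) => [av|dv].
  have ovs := open_vs kk' vw dw av h2; have ows := open_ws kk' vw dw av h2.
  suff H z : open_itv v w z -> (Q z <-> Q (vswap k k' v)).
    by move=> x y ox oy; rewrite (H x) // (H y).
  have Hd x : open_itv v w x -> ~~ asc x k k' -> (Q x <-> Q (vswap k k' v)).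
    by move=> ox ax; case/and4P: (ox) => vx xw _ _; apply: iff_sym; apply: QQ => //; exact: vs_le.
  have Ha x : open_itv v w x -> asc x k k' -> (Q x <-> Q (vswap k k' w)).
    by move=> ox ax; case/and4P: (ox) => vx xw _ _; apply: QQ => //; exact: le_ws.
  have vws : ble v (vswap k k' w) by exact: le_ws.
  (* The bridge is an atom [x] of $[v,ws]$: it lies below $ws$, and [x] or $xs$ has a descent and
     lies above $vs$. Length at least 3 keeps $xs$ strictly below [w]. *)
  have [|x [vx xws ex]] := ble_atom vws; first by apply/eqP => e; move: ews; rewrite -e; nlia.
  have ox : open_itv v w x.
    by apply: open_itvI => //; [exact: ble_trans xws (ws_le kk' dw) | nlia].
  have Qx : Q x <-> Q (vswap k k' w) by apply: QQ.
  move=> oz; case: (boolP (asc z k k')) => az; last exact: Hd.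
  rewrite (Ha _ oz az) -Qx; case: (boolP (asc x k k')) => ax; last exact: Hd.
  have oxs : open_itv v w (vswap k k' x).
    case/and4P: ox => _ xw _ _; rewrite -(upA ax); apply: open_itvI.
    - exact: ble_trans vx (le_up kk' x).
    - exact: up_le.
    - by rewrite upA // (asc_ninv kk' ax) ex; nlia.
  rewrite (_ : Q x <-> Q (vswap k k' x)); first by apply: Hd => //; rewrite asc_s // ax.
  by apply: QQ => //; exact: asc_ble.
have [Q1 Q2] := fold_transfer kk' dw dv h2 QQ.
move=> x y ox oy; rewrite (Q2 _ ox) (Q2 _ oy).
have evs := ninv_vs kk' dv.
apply: (IH _ _ _ _ _ _ Q1); [nlia | | nlia | exact: fold_open | exact: fold_open].
by rewrite -(downD dv) -(downD dw); exact: ble_down.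
Qed.

(** In length 2 an element with an ascent can only be $ws$; if [v] has an ascent, an element with a
    descent can only be $vs$. With descents at both ends [fold_desc] is injective and the induction
    applies. *)
Lemma open_itv_thin v w x y z : ble v w -> ninv w = ninv v + 2 ->
  open_itv v w x -> open_itv v w y -> open_itv v w z -> x != y -> z = x \/ z = y.
Proof.
have [d] := ubnP (ninv w); elim: d v w x y z => // d IH v w x y z; rewrite ltnS => hd vw h ox oy oz.
have rk t : open_itv v w t -> ninv t = (ninv v).+1 by move/open_itv_ninv; nlia.
have w1 : w != 1%g by apply/eqP => e; move: h; rewrite e ninv1; nlia.
have [k [k' [kk' dw]]] := exists_desc w1; have ews := ninv_ws kk' dw.
have h2 : ninv v + 2 <= ninv w by nlia.
have Ha t : open_itv v w t -> asc t k k' -> t = (vswap k k' w).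
  move=> ot at_; case/and4P: (ot) => _ tw _ _; apply: ble_ninv_eq (le_ws kk' dw tw at_) _.
  rewrite (rk _ ot); nlia.
case: (boolP (asc v k k')) => [av|dv].
  have Hd t : open_itv v w t -> ~~ asc t k k' -> t = (vswap k k' v).
    move=> ot at_; case/and4P: (ot) => vt _ _ _; apply/esym/(ble_ninv_eq (vs_le kk' av vt at_)).
    by rewrite rk // (asc_ninv kk' av).
  move=> nxy; case: (boolP (asc x k k')) => ax; case: (boolP (asc y k k')) => ay.
  - by rewrite (Ha _ ox ax) (Ha _ oy ay) eqxx in nxy.
  - by case: (boolP (asc z k k')) => az; [left; rewrite (Ha _ oz az) (Ha _ ox ax) | right;
      rewrite (Hd _ oz az) (Hd _ oy ay)].
  - by case: (boolP (asc z k k')) => az; [right; rewrite (Ha _ oz az) (Ha _ oy ay) | left;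
      rewrite (Hd _ oz az) (Hd _ ox ax)].
  - by rewrite (Hd _ ox ax) (Hd _ oy ay) eqxx in nxy.
have finj a b : open_itv v w a -> open_itv v w b ->
    fold_desc k k' v a = fold_desc k k' v b -> a = b.
  move=> oa ob; rewrite /fold_desc; case: ifP => aa; case: ifP => ab.
  - by rewrite (Ha _ oa aa) (Ha _ ob ab).
  - by move=> e; move: dv; rewrite e (asc_s kk') ab.
  - by move=> e; move: dv; rewrite -e (asc_s kk') aa.
  - exact: vswap_inj.
have evs := ninv_vs kk' dv.
move=> nxy; have := IH (vswap k k' v) (vswap k k' w) _ _ _ _ _ _ (fold_open kk' dw dv h2 ox)
  (fold_open kk' dw dv h2 oy) (fold_open kk' dw dv h2 oz).
case.
- nlia.
- by rewrite -(downD dv) -(downD dw); exact: ble_down.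
- nlia.
- by apply: contraNneq nxy => /finj ->.
- by move=> /finj ->; [left|..].
- by move=> /finj ->; [right|..].
Qed.

End Bruhat3.

(** * Coxeter matroids *)

Section CoxeterMatroid.
Variable n : nat.
Implicit Types (x y z u v w s t m : 'S_n) (p q i j k : 'I_n) (Y : {set 'S_n}).

(* [s^-1 * z] lists the values of [z] along the positions in the order [s], so this
   is the maximality property of Gelfand and Serganova. *)
Definition coxeter_matroid Y := forall s, exists2 m, m \in Y & forall z, z \in Y ->
  ble (s^-1 * m)%g (s^-1 * z)%g.

Definition bruhat_itv v w := [set z | ble v z && ble z w].

Lemma corank_full z a : corank z a n = (\sum_(k < n) (k < a))%N.
Proof.
rewrite /corank (reindex_inj (@perm_inj _ z^-1%g)) /=.
by apply: eq_bigr => i _; rewrite ltn_ord permKV.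
Qed.

Definition rev_perm : 'S_n := perm (@rev_ord_inj n).

Lemma corank_rev z a r : (r <= n)%N ->
  (corank (rev_perm * z)%g a r + corank z a (n - r) = corank z a n)%N.
Proof.
move=> rn; rewrite {1}/corank (reindex_inj (@rev_ord_inj n)) /corank -big_split /=.
apply: eq_bigr => i _; rewrite permM permE rev_ordK ltn_ord /=.
have := ltn_ord i; case: (z i < a)%N; rewrite ?andbF // !andbT => lt.
have -> : (n - i.+1 < r)%N = ~~ (i < n - r)%N by rewrite -leqNgt; lia.
by case: (_ < _)%N.
Qed.

Lemma ble_rev x y : ble (rev_perm * x)%g (rev_perm * y)%g -> ble y x.
Proof.
move=> /bleP H; apply/bleP => a r; rewrite corank_minn [leqRHS]corank_minn.
set r' := minn r n; have rn : (r' <= n)%N by rewrite geq_minr.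
have e t : (corank (rev_perm * t)%g (minn a n) (n - r') + corank t (minn a n) r' =
  \sum_(k < n) (k < minn a n))%N.
  by rewrite -(corank_full t) -(corank_rev t _ (leq_subr r' n)) subKn.
by have := H (minn a n) (n - r')%N; have := e x; have := e y; lia.
Qed.

(** The natural order of positions gives the minimum; the reversed one gives the maximum, because
    reversing positions reverses Bruhat order. *)
Lemma coxeter_matroid_minmax Y : coxeter_matroid Y ->
  exists x y, [/\ x \in Y, y \in Y & Y \subset bruhat_itv x y].
Proof.
move=> cY; have [x xY xm] := cY 1%g; have [y yY ym] := cY rev_perm^-1%g.
exists x, y; split=> //; apply/subsetP => z zY; rewrite inE.
have := xm z zY; rewrite invg1 !mul1g => -> /=.
by have := ym z zY; rewrite invgK; exact: ble_rev.
Qed.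

End CoxeterMatroid.

(** * Linear forms on Coxeter matroids *)

Section Faces.
Variables (R : realFieldType) (n : nat).
Implicit Types (x y z u v w s t m : 'S_n) (p q i j k : 'I_n) (Y : {set 'S_n}) (c : 'rV[R]_n).

(** Values start at 0 here and at 1 in [perm_point]; the difference $\sum_i c_i$ does not depend on
    [z], so the maximizers are the same. *)
Definition lval c z := \sum_i c 0 i * (z i)%:R.

(* [c] assigns a weight to each position; [x] and [y] place every value at positions
   of equal weight. *)
Definition same_levels c x y := [forall k, c 0 (x^-1 k)%g == c 0 (y^-1 k)%g].

Definition maxset c Y := [set z in Y | [forall y in Y, lval c y <= lval c z]].

Lemma same_levelsP c x y : reflect (forall k, c 0 (x^-1 k)%g = c 0 (y^-1 k)%g) (same_levels c x y).
Proof. exact: 'forall_eqP. Qed.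

Lemma same_levels_refl c x : same_levels c x x. Proof. exact/same_levelsP. Qed.
Lemma same_levels_sym c x y : same_levels c x y = same_levels c y x.
Proof. by apply/same_levelsP/same_levelsP => H k; rewrite H. Qed.
Lemma same_levels_trans c y x z : same_levels c x y -> same_levels c y z -> same_levels c x z.
Proof. by move=> /same_levelsP a /same_levelsP b; apply/same_levelsP => k; rewrite a b. Qed.

Lemma lval_levels c x : lval c x = \sum_k c 0 (x^-1 k)%g * (k : nat)%:R.
Proof.
rewrite /lval (reindex_inj (@perm_inj _ x^-1%g)).
by apply: eq_bigr => i _; rewrite permKV.
Qed.

Lemma same_levels_lval c x y : same_levels c x y -> lval c x = lval c y.
Proof. by move/same_levelsP => e; rewrite !lval_levels; apply: eq_bigr => k _; rewrite e. Qed.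

Lemma sumr_split2 (F : 'I_n -> R) p q : p != q ->
  \sum_(i < n) F i = F p + F q + \sum_(i < n | (i != p) && (i != q)) F i.
Proof. by move=> pq; rewrite (bigD1 p) //= (bigD1 q) /= ?addrA // eq_sym. Qed.

Lemma lval_pswap c x p q : p != q ->
  lval c x - lval c (pswap p q x) = (c 0 q - c 0 p) * ((x q)%:R - (x p)%:R).
Proof.
move=> pq; rewrite /lval !(sumr_split2 _ pq) pswapL pswapR.
rewrite [X in _ - (_ + X)](eq_bigr (fun i => c 0 i * (x i)%:R)); first by ring.
by move=> i /andP[ip iq]; rewrite pswapD.
Qed.

Lemma pswap_inv x p q k : ((pswap p q x)^-1 k = tperm p q (x^-1 k))%g.
Proof. by rewrite /pswap invMg permM tpermV. Qed.

Lemma same_levels_pswap c x p q : c 0 p = c 0 q -> same_levels c x (pswap p q x).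
Proof. by move=> e; apply/same_levelsP => k; rewrite pswap_inv; case: tpermP => [->|->|]. Qed.

Lemma mul_pswap s x p q : (s * pswap p q x)%g = pswap (s^-1 p)%g (s^-1 q)%g (s * x)%g.
Proof.
by rewrite /pswap mulgA -(mulgKV s (tperm p q)) -[in RHS]tpermJ /conjg !mulgA invgK mulgKV.
Qed.

Lemma sort_perm c s : exists t : 'S_n, forall i j,
  (t i < t j)%N = (c 0 i < c 0 j) || (c 0 i == c 0 j) && (s i < s j)%N.
Proof.
pose lt i j := (c 0 i < c 0 j) || (c 0 i == c 0 j) && (s i < s j)%N.
have irr i : lt i i = false by rewrite /lt ltxx ltnn andbF.
have trans i j k : lt i j -> lt j k -> lt i k.
  rewrite /lt => /orP[a|/andP[/eqP e a]] /orP[b|/andP[/eqP e' b]].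
  - by rewrite (lt_trans a b).
  - by rewrite -e' a.
  - by rewrite e b.
  - by rewrite e e' eqxx (ltn_trans a b) orbT.
have tot i j : i != j -> lt i j || lt j i.
  rewrite /lt => ij; case: (ltgtP (c 0 i) (c 0 j)) => //= _.
  by rewrite -neq_ltn (inj_eq val_inj) (inj_eq perm_inj).
pose rk i := #|[set j | lt j i]|.
have rkn i : (rk i < n)%N.
  rewrite -[X in (_ < X)%N]card_ord -cardsT; apply: proper_card.
  by apply/properP; split=> //; exists i; rewrite ?inE ?irr.
have rklt i j : lt i j -> (rk i < rk j)%N.
  move=> ij; apply: proper_card; apply/properP; split.
    by apply/subsetP => k; rewrite !inE => /trans; apply.
  by exists i; rewrite inE ?ij ?irr.
have rkE i j : (rk i < rk j)%N = lt i j.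
  apply/idP/idP; last exact: rklt.
  case: (altP (i =P j)) => [->|/tot/orP[//|/rklt]]; first by rewrite ltnn.
  by rewrite ltnNge => /negbTE h /ltnW; rewrite h.
have inj : injective (fun i => Ordinal (rkn i)).
  move=> i j [e]; apply/eqP; apply: contraT => /tot; rewrite -!rkE e ltnn //.
by exists (perm inj) => i j; rewrite !permE; exact: rkE.
Qed.

(* [t] orders the positions by weight, with ties broken by [s]. Along a Bruhat chain
   in the order [t] the form can only drop; when it does not, each transposition
   of the chain exchanges positions of equal weight, on which [s] agrees with [t]. *)
Lemma lval_sorted c s t : (forall i j,
    (t i < t j)%N = (c 0 i < c 0 j) || (c 0 i == c 0 j) && (s i < s j)%N) ->
  forall z m, ble (t^-1 * m)%g (t^-1 * z)%g ->
  lval c z <= lval c m /\ (lval c m <= lval c z ->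
    same_levels c m z /\ ble (s^-1 * m)%g (s^-1 * z)%g).
Proof.
move=> tE z m.
suff H x : ble x (t^-1 * z)%g -> lval c z <= lval c (t * x)%g /\
    (lval c (t * x)%g <= lval c z ->
      same_levels c (t * x)%g z /\ ble (s^-1 * (t * x))%g (s^-1 * z)%g).
  by move=> /H; rewrite mulKVg.
move: x; apply: ble_ind => [|x p q /and3P[pq xpq _] _ [IH1 IH2]].
  by rewrite mulKVg; split=> // _; split; [exact: same_levels_refl | exact: ble_refl].
set p' := (t^-1 p)%g; set q' := (t^-1 q)%g.
have npq : p' != q' by rewrite (inj_eq perm_inj) -val_eqE /= neq_ltn pq.
have e : (t * pswap p q x)%g = pswap p' q' (t * x)%g by rewrite mul_pswap.
have le : c 0 p' <= c 0 q'.
  have := tE p' q'; rewrite !permKV pq => /esym/orP[/ltW//|/andP[/eqP-> _]//].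
have := lval_pswap c (t * x)%g npq; rewrite -e => d.
have xx : (0 : R) < (x q)%:R - (x p)%:R by rewrite subr_gt0 ltr_nat.
have xE r : ((t * x)%g (t^-1 r)%g = x r)%g by rewrite permM permKV.
rewrite !xE in d.
have d0 : lval c (t * pswap p q x)%g <= lval c (t * x)%g.
  by rewrite -subr_ge0 d mulr_ge0 ?subr_ge0 // -subr_ge0 ltW.
split; first exact: le_trans IH1 d0.
move=> le2; have [] := IH2 (le_trans d0 le2) => c1 b1.
have cc : c 0 p' = c 0 q'.
  apply/eqP; rewrite eq_le le /=.
  have : lval c (t * x)%g - lval c (t * pswap p q x)%g <= 0 by rewrite subr_le0 (le_trans le2).
  by rewrite d pmulr_lle0 // subr_le0.
split.
  by apply: same_levels_trans c1; rewrite e; exact: same_levels_pswap.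
apply: ble_trans b1; rewrite e mul_pswap; apply: ble_pswap; rewrite invgK.
  by have := tE p' q'; rewrite !permKV pq cc ltxx eqxx /= => /esym.
by rewrite permM permK xE permM permK xE.
Qed.

(** Refine the order by weight with [s] to an order [t]. The [t]-minimum of [Y] maximizes the form,
    is level with every other maximizer, and precedes them all in the order [s]. *)
Lemma coxeter_matroid_face c Y : coxeter_matroid Y ->
  coxeter_matroid (maxset c Y) /\ {in maxset c Y &, forall x y, same_levels c x y}.
Proof.
move=> cY.
have H s : exists2 m, m \in maxset c Y & forall z, z \in maxset c Y ->
    same_levels c m z /\ ble (s^-1 * m)%g (s^-1 * z)%g.
  have [t tE] := sort_perm c s; have [m mY mm] := cY t; exists m.
    rewrite inE mY /=; apply/forall_inP => y yY.
    by have [] := lval_sorted tE (mm y yY).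
  move=> z; rewrite inE => /andP[zY /forall_inP zm].
  by have [_] := lval_sorted tE (mm z zY); apply; exact: zm.
split=> [s|x y xM yM]; first by have [m mM mm] := H s; exists m => // z /mm[].
have [m mM mm] := H 1%g; have [mx _] := mm x xM; have [my _] := mm y yM.
by apply: same_levels_trans my; rewrite same_levels_sym.
Qed.

End Faces.

(** * Flags in Richardson varieties *)

Section FlagMatroid.
Variables (F : fieldType) (n : nat).
Implicit Types (x y z v w s t m : 'S_n) (i j : 'I_n) (Y : {set 'S_n}) (G B : 'M[F]_n) (u :
  'rV[F]_n).

(** For such [u] the products [u *m G] run through the [k]-th space of the flag. *)
Definition supp k u := forall l : 'I_n, (k <= l)%N -> u 0 l = 0.

(* The leading [k] rows of [G] span the [k]-th space of a flag; membership of [z] says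
   that the minors of these rows in the columns $\{i : z_i < k\}$ do not vanish. *)
Definition flag_matroid G : {set 'S_n} :=
  [set z : 'S_n | `[< forall k u, supp k u -> (forall i, (z i < k)%N -> (u *m G) 0 i = 0) ->
    u = 0 >]].

Lemma perm_le_eq (x y : 'S_n) : (forall i, (x i <= y i)%N) -> x = y.
Proof.
move=> le; apply/permP => i; apply/val_inj/eqP.
have h (z : 'S_n) : (\sum_(i < n) z i = \sum_(i < n) i)%N by rewrite [RHS](reindex_inj
  (@perm_inj _ z)).
have /leqif_sum[_] : forall k : 'I_n, true -> ((x k <= y k ?= iff (x k == y k :> nat))%N).
  by move=> k _; exact/leqif_eq/le.
by rewrite !h eqxx => /esym/forall_inP/(_ i isT).
Qed.

Lemma corank_order s z a r : corank (s^-1 * z)%g a r = #|[set i | (s i < r)%N && (z i < a)%N]|.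
Proof.
rewrite /corank (reindex_inj (@perm_inj _ s)) /=.
under eq_bigr => i _ do rewrite permM permK.
by rewrite -big_mkcond /= sum1_card; apply: eq_card => i; rewrite inE.
Qed.

Section Flag.
Variable G : 'M[F]_n.
Hypothesis Gu : G \in unitmx.

Lemma mulG_inj u : u *m G = 0 -> u = 0.
Proof. by move=> e; rewrite -[u](mulmxK Gu) e mul0mx. Qed.

(** There are fewer linear conditions than the [k] free coefficients. *)
Lemma flag_solution (S : {set 'I_n}) k : (k <= n)%N -> (#|S| < k)%N ->
  exists u, [/\ supp k u, u != 0 & forall i, i \in S -> (u *m G) 0 i = 0].
Proof.
move=> kn Sk; pose f := widen_ord kn.
pose A := colsub (@enum_val _ (mem S)) (rowsub f G).
have : kermx A != 0.
  rewrite kermx_eq0 /row_free; apply/eqP => e.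
  by have := rank_leq_col A; rewrite e leqNgt Sk.
case/rowV0Pn => v0 /sub_kermxP v0A v0n.
exists (v0 *m rowsub f 1%:M).
have uE l : (v0 *m rowsub f 1%:M) 0 l = \sum_k' v0 0 k' * (f k' == l)%:R.
  by rewrite mxE; apply: eq_bigr => k' _; rewrite !mxE.
split.
- move=> l kl; rewrite uE big1 // => k' _.
  rewrite (_ : (f k' == l) = false) ?mulr0 //; apply/eqP => e.
  by move: kl; rewrite -e /= leqNgt ltn_ord.
- apply: contraNneq v0n => e; apply/eqP/rowP => k'; rewrite [RHS]mxE.
  have := uE (f k'); rewrite e mxE (bigD1 k') //= eqxx mulr1 big1 ?addr0 // => l lk.
  by rewrite -val_eqE /= val_eqE (negbTE lk) mulr0.
move=> i iS; rewrite -mulmxA mul_rowsub_mx mul1mx.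
have := congr1 (fun M : 'rV_ _ => M 0 (enum_rank_in iS i)) v0A.
rewrite /= mulmx_colsub mxE (enum_rankK_in iS iS) => ->.
by rewrite mxE.
Qed.

Variable s : 'S_n.

(* The [k+1]-st space of the flag has a vector whose first nonzero entry, in the
   order [s], is at [i]; the least such [k] reads off the Bruhat cell of the flag. *)
Definition jump i k := `[< exists u, [/\ supp k.+1 u,
  forall j, (s j < s i)%N -> (u *m G) 0 j = 0 & (u *m G) 0 i != 0] >].

Lemma jump_last i : jump i n.-1.
Proof.
apply/asboolP; exists (row i (invmx G)); rewrite -row_mul mulVmx //.
split=> [l nl|j ji|]; first by have := leq_trans (ltn_ord l) (leq_trans (leqSpred n) nl);
  rewrite ltnn.
  by rewrite !mxE; case: eqP ji => // ->; rewrite ltnn.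
by rewrite !mxE eqxx oner_eq0.
Qed.

Lemma exists_jump i : exists k, jump i k. Proof. by exists n.-1; exact: jump_last. Qed.

Definition level i := ex_minn (exists_jump i).

Lemma level_le i k : jump i k -> (level i <= k)%N.
Proof. by rewrite /level; case: ex_minnP => l _; apply. Qed.

Lemma level_ltn i : (level i < n)%N.
Proof.
by apply: leq_ltn_trans (level_le (jump_last i)) _; rewrite prednK //; apply: leq_trans (ltn_ord i).
Qed.

Definition leveln i := Ordinal (level_ltn i).

Lemma level_jump i : jump i (level i).
Proof. by rewrite /level; case: ex_minnP. Qed.

Lemma level_neq0 i u : supp (level i).+1 u ->
  (forall j, (s j < s i)%N -> (u *m G) 0 j = 0) -> (u *m G) 0 i != 0 -> u 0 (leveln i) != 0.
Proof.
move=> su uv un; apply/eqP => e.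
have su' : supp (level i) u.
  move=> l; rewrite leq_eqVlt => /orP[/eqP el|]; last exact: su.
  by rewrite -e; congr (u _ _); apply: val_inj.
case el : (level i) su' => [|k] su'.
  have u0 : u = 0 by apply/rowP => l; rewrite su' // mxE.
  by move: un; rewrite u0 mul0mx mxE eqxx.
suff : (level i <= k)%N by rewrite el ltnn.
by apply: level_le; apply/asboolP; exists u.
Qed.

(** If two positions had the same level, a multiple of the later vector could be subtracted from the
    earlier one to cancel the top coefficient. The first nonzero position would stay the same,
    against the minimality of the level. *)
Lemma leveln_inj : injective leveln.
Proof.
suff H i j : (s i < s j)%N -> leveln i = leveln j -> False.
  move=> i j e; case: (ltngtP (s i) (s j)) => [/H/(_ e)//|/H/(_ (esym e))//|/val_inj/perm_inj//].
move=> ij e; have el : level i = level j by case: e.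
have /asboolP[u [su uv un]] := level_jump i.
have /asboolP[u' [su' uv' un']] := level_jump j.
have n1 := level_neq0 su uv un; have n2 := level_neq0 su' uv' un'; rewrite -e in n2.
pose a := u 0 (leveln i) / u' 0 (leveln i).
have lin l : ((u - a *: u') *m G) 0 l = (u *m G) 0 l - a * (u' *m G) 0 l.
  by rewrite mulmxBl -scalemxAl mxE [X in _ + X]mxE [X in _ - X]mxE.
suff : (u - a *: u') 0 (leveln i) != 0 by rewrite !mxE /a mulfVK // subrr eqxx.
apply: level_neq0.
- by move=> l ll; rewrite !mxE su // su' ?mulr0 ?subr0 // -el.
- by move=> l li; rewrite lin uv // uv' ?mulr0 ?subr0 // (ltn_trans li).
- by rewrite lin uv' // mulr0 subr0.
Qed.

Definition min_perm := perm leveln_inj.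

Lemma min_perm_le i k u : supp k.+1 u -> (forall j, (s j < s i)%N -> (u *m G) 0 j = 0) ->
  (u *m G) 0 i != 0 -> (min_perm i <= k)%N.
Proof. by move=> su uv un; rewrite permE; apply: level_le; apply/asboolP; exists u. Qed.

Lemma first_nonzero k u : supp k u -> u != 0 ->
  exists i, [/\ (u *m G) 0 i != 0, forall j, (s j < s i)%N ->
    (u *m G) 0 j = 0 & (min_perm i < k)%N].
Proof.
move=> su un.
have [i0 i0n] : exists i, (u *m G) 0 i != 0.
  apply/existsP; apply: contraR un => /existsPn H; apply/eqP/mulG_inj/rowP => i.
  by rewrite [RHS]mxE; apply/eqP; move: (H i); rewrite negbK.
case: (@arg_minnP _ i0 (fun i => (u *m G) 0 i != 0) (fun i => s i : nat) i0n) => i iN imin.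
have before j : (s j < s i)%N -> (u *m G) 0 j = 0.
  by move=> ji; apply/eqP; apply: contraLR ji => /imin; rewrite -leqNgt.
exists i; split=> //; case: k su => [|k] su; last exact: min_perm_le before iN.
by case/eqP: un; apply/rowP => l; rewrite su // mxE.
Qed.

Lemma min_perm_in : min_perm \in flag_matroid G.
Proof.
rewrite inE; apply/asboolP => k u su uv; apply/eqP; apply: contraT => un.
by have [i [iN _ ik]] := first_nonzero su un; rewrite uv ?eqxx in iN.
Qed.

Lemma min_perm_min z : z \in flag_matroid G -> ble (s^-1 * min_perm)%g (s^-1 * z)%g.
Proof.
rewrite inE => /asboolP zG; apply/forallP => a; apply/forallP => r; rewrite !corank_order leqNgt.
apply/negP; set I := [set i | _ & (z i < a)%N]; set B := [set i | _] => BI.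
pose T := [set i | (z i < a)%N].
have an : (a <= n)%N by rewrite -ltnS.
have cT : #|T| = a.
  have -> : #|T| = corank z a n.
    by rewrite /corank -big_mkcond /= sum1_card; apply: eq_card => i; rewrite inE unfold_in ltn_ord.
  rewrite corank_full -big_mkcond /= -(big_ord_widen n (fun=> 1%N)) //.
  by rewrite sum_nat_const card_ord muln1.
have IT : I \subset T by apply/subsetP => i; rewrite !inE => /andP[].
(* A failure of the order at [a], [r] means that [B] is smaller than [I], so these are fewer than
   [a] conditions. The first nonzero position of the solution avoids [B] and hence comes at [r] or
   later; so the solution vanishes on [I] too, thus on all of [T], against [z] being in the
   matroid. *)
have [|u [su un uv]] := @flag_solution ((T :\: I) :|: B) a an.
  apply: leq_ltn_trans (leq_card_setU _ _) _; rewrite cardsD (setIidPr IT) cT.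
  by have := subset_leq_card IT; rewrite cT; lia.
have [i [iN ib ia]] := first_nonzero su un.
have nB : i \notin B by apply: contra iN => iB; rewrite uv // inE iB orbT.
have sr : (r <= s i)%N by move: nB; rewrite inE ia andbT -leqNgt.
have /eqP[] := un.
apply: (zG a) => // j jT.
case: (boolP (j \in I)) => jI; last first.
  by apply: uv; rewrite in_setU in_setD jI inE jT.
by apply: ib; move: jI; rewrite inE => /andP[jr _]; apply: leq_trans jr sr.
Qed.
End Flag.

Lemma flag_coxeter_matroid G : G \in unitmx -> coxeter_matroid (flag_matroid G).
Proof. by move=> Gu s; exists (min_perm Gu s); [exact: min_perm_in | exact: min_perm_min]. Qed.

Lemma rev_permV : (rev_perm n)^-1%g = rev_perm n.
Proof.
by apply/permP => i; apply: (@perm_inj _ (rev_perm n)); rewrite permKV !permE rev_ordK.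
Qed.

(* The flag spanned by the rows of [G] lies in the open Richardson variety of [v] and
   [w]. It is built along a reduced word of [w] by changing the [k]-th space inside
   the pencil between its neighbours: row [k] becomes row [k + 1] if [s] is also a
   descent of [v], and the sum of the two rows otherwise. *)
Lemma exists_flag v w : ble v w -> exists G B, [/\
  forall j, (forall i, (i < (v^-1)%g j)%N -> G j i = 0) /\ G j ((v^-1)%g j) != 0,
  forall j k : 'I_n, (j < k)%N -> B j k = 0,
  forall j, B j j != 0 &
  forall j, (forall i, ((w^-1)%g j < i)%N -> (B *m G) j i = 0) /\ (B *m G) j ((w^-1)%g j) != 0].
Proof.
have [d] := ubnP (ninv w); elim: d v w => // d IH v w; rewrite ltnS => hd vw.
have [w1|w1] := altP (w =P 1%g).
  have -> : v = 1%g by rewrite -w1; apply: ble_ninv_eq vw _; rewrite w1 ninv1.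
  exists 1%:M, 1%:M; rewrite w1 mulmx1 invg1; split=> [j|j k jk|j|j];
    rewrite ?perm1 ?mxE ?eqxx ?oner_eq0 //.
  - by split=> // i ij; rewrite mxE; case: eqP ij => // ->; rewrite ltnn.
  - by case: eqP jk => // ->; rewrite ltnn.
  - by split=> // i ij; rewrite mxE; case: eqP ij => // ->; rewrite ltnn.
have [k [k' [kk' dw]]] := exists_desc w1.
have kltk' : (k < k')%N by rewrite kk'.
have nkk' : k != k' by rewrite -val_eqE /= neq_ltn kltk'.
(* In $ws$ the last entry of row [k] comes before that of row [k']. Subtracting a multiple of row
   [k] from row [k'] thus keeps its last entry, and exchanging the two rows turns $ws$ into [w]. *)
have lastE (w0 : 'S_n) : w0 = vswap k k' w -> asc w0 k k' -> forall H H' : 'M[F]_n, forall b,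
   (forall j, (forall i, ((w0^-1)%g j < i)%N -> H j i = 0) /\ H j ((w0^-1)%g j) != 0) ->
   (forall i, H' k i = H k' i - b * H k i) -> (forall i, H' k' i = H k i) ->
   (forall j i, j != k -> j != k' -> H' j i = H j i) ->
   forall j, (forall i, ((w^-1)%g j < i)%N -> H' j i = 0) /\ H' j ((w^-1)%g j) != 0.
  move=> ew aw H H' b HH e1 e2 e3 j.
  have wE : (w^-1 j)%g = (w0^-1 (tperm k k' j))%g.
    by rewrite ew /vswap invMg permM tpermV tpermK.
  have [Hk Hk0] := HH k; have [Hk' Hk'0] := HH k'.
  rewrite wE; case: tpermP => [->|->|/eqP jk /eqP jk'].
  - split=> [i ii|]; first by rewrite e1 Hk' // Hk ?mulr0 ?subr0 // (ltn_trans aw).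
    by rewrite e1 [H k _]Hk // mulr0 subr0.
  - by split=> [i ii|]; rewrite e2 // Hk.
  - by have [a c] := HH j; split=> [i ii|]; rewrite e3 // a.
have ew : (ninv (vswap k k' w) < d)%N by have := ninv_ws kk' dw; lia.
have aw : asc (vswap k k' w) k k' by rewrite (asc_s kk').
case: (boolP (asc v k k')) => [av|dv].
  have [G [B [Glead Blow Bdiag Hlast]]] := IH v (vswap k k' w) ew (le_ws kk' dw vw av).
  (* As [v] has an ascent, adding row [k'] does not disturb the leading entry of row [k]. [C] below
     expresses the old rows of [B *m G] in the new rows. *)
  pose G' := \matrix_(j, i) (if j == k then G k i + G k' i else G j i).
  pose C j l := B j l - (l == k')%:R * B j k.
  (* Chosen to cancel the entry of [B'] at [k], [k'], the only one that could spoil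
     triangularity. *)
  pose b := (B k' k - B k' k') / B k k.
  pose B' := \matrix_(j,
    l) (if j == k then C k' l - b * C k l else if j == k' then C k l else C j l).
  have CG j i : \sum_l C j l * G' l i = (B *m G) j i.
    rewrite mxE (bigD1 k) //= (bigD1 k') 1?eq_sym //= [RHS](bigD1 k) //= [in RHS](bigD1 k')
      1?eq_sym //=.
    rewrite /C !mxE !eqxx (negbTE nkk') eq_sym (negbTE nkk').
    rewrite (eq_bigr (fun l => B j l * G l i));
      first by rewrite [false%:R]mulr0n [true%:R]mulr1n; ring.
    by move=> l /andP[lk lk']; rewrite mxE (negbTE lk) (negbTE lk') mul0r subr0.
  exists G', B'; split.
  - move=> j; have [Gk Gk0] := Glead k; have [Gk' Gk'0] := Glead k'; have [Gj Gj0] := Glead j.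
    split=> [i ii|]; rewrite mxE; case: (altP (j =P k)) => [e|_] //.
    + by rewrite e in ii; rewrite Gk // Gk' ?addr0 // (ltn_trans ii).
    + exact: Gj.
    + by rewrite e Gk' // addr0.
  - move=> j l jl; rewrite mxE /C; case: eqP => [e|/eqP jk].
      case: (altP (l =P k')) => [->|lk'].
        rewrite !mul1r [B k k']Blow // /b; field; exact: Bdiag.
      have lk2 : (k' < l)%N by rewrite e in jl; move: lk'; rewrite -val_eqE /=; lia.
      by rewrite !mul0r !subr0 Blow // [B k l]Blow ?mulr0 ?subr0 // (ltn_trans kltk').
    case: eqP => [e|/eqP jk'].
      have lk2 : (k' < l)%N by rewrite -e.
      rewrite (_ : (l == k') = false) ?mul0r ?subr0 ?Blow ?(ltn_trans kltk') //.
      by apply/eqP => el; rewrite el ltnn in lk2.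
    rewrite Blow //; case: eqP => [e|_]; last by rewrite mul0r subr0.
    by rewrite Blow ?mulr0 ?subr0 //; rewrite e in jl; move: jk jk'; rewrite -!val_eqE /=; lia.
  - move=> j; rewrite mxE /C; case: (altP (j =P k)) => [e|jk].
      rewrite e (negbTE nkk') !mul0r !subr0.
      rewrite (_ : _ - _ = B k' k') ?Bdiag // /b; field; exact: Bdiag.
    case: (altP (j =P k')) => [e|jk']; last by rewrite mul0r subr0 Bdiag.
    by rewrite e mul1r Blow // sub0r oppr_eq0 Bdiag.
  - apply: (lastE _ erefl aw (B *m G) _ b Hlast) => [i|i|j i jk jk'].
    + rewrite -!CG mxE mulr_sumr -sumrB; apply: eq_bigr => l _; rewrite [B' _ _]mxE eqxx; ring.
    + by rewrite -!CG mxE; apply: eq_bigr => l _; rewrite [B' _ _]mxE eqxx eq_sym (negbTE nkk').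
    + by rewrite -!CG mxE; apply: eq_bigr => l _; rewrite [B' _ _]mxE (negbTE jk) (negbTE jk').
have vw' : ble (vswap k k' v) (vswap k k' w) by rewrite -(downD dv) -(downD dw); exact: ble_down.
have [G [B [Glead Blow Bdiag Hlast]]] := IH _ _ ew vw'.
pose t := tperm k k'.
pose G' := \matrix_(j, i) G (t j) i.
pose b := B k' k / B k k.
pose B' := \matrix_(j, l) (if j == k then B k' (t l) - b * B k (t l) else
  if j == k' then B k (t l) else B j (t l)).
have CG j i : \sum_l B j (t l) * G' l i = (B *m G) j i.
  rewrite mxE [RHS](reindex_inj (@perm_inj _ t)) /=.
  by apply: eq_bigr => l _; rewrite mxE.
exists G', B'; split.
- move=> j; have := Glead (t j); rewrite (_ : ((vswap k k' v)^-1 (t j) = v^-1 j)%g); last first.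
    by rewrite /vswap invMg permM tpermV tpermK.
  by case=> a c; split=> [i ii|]; rewrite mxE // a.
- move=> j l jl; rewrite mxE; case: eqP => [e|/eqP jk].
    rewrite /t; case: tpermP => [el|el|/eqP lk /eqP lk'].
    + by rewrite e el ltnn in jl.
    + rewrite /b; field; exact: Bdiag.
    + have lk2 : (k' < l)%N by rewrite e in jl; move: lk'; rewrite -val_eqE /=; lia.
      by rewrite Blow // [B k l]Blow ?mulr0 ?subr0 // (ltn_trans kltk').
  case: eqP => [e|/eqP jk'].
    have lk2 : (k' < l)%N by rewrite -e.
    by rewrite tpermD ?Blow ?(ltn_trans kltk') // neq_ltn ?lk2 ?(ltn_trans kltk' lk2).
  rewrite /t; case: tpermP => [el|el|/eqP lk /eqP lk']; last by rewrite Blow.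
    by rewrite Blow // (ltn_trans _ kltk') // -el.
  by rewrite Blow //; rewrite el in jl; move: jk jk'; rewrite -!val_eqE /=; lia.
- move=> j; rewrite mxE /t; case: (altP (j =P k)) => [e|jk].
    by rewrite e tpermL [B k k']Blow // mulr0 subr0.
  case: (altP (j =P k')) => [e|jk']; first by rewrite e tpermR.
  by rewrite tpermD // eq_sym.
- apply: (lastE _ erefl aw (B *m G) _ b Hlast) => [i|i|j i jk jk'].
  + rewrite -!CG mxE mulr_sumr -sumrB; apply: eq_bigr => l _; rewrite [B' _ _]mxE eqxx; ring.
  + by rewrite -!CG mxE; apply: eq_bigr => l _; rewrite [B' _ _]mxE eqxx eq_sym (negbTE nkk').
  + by rewrite -!CG mxE; apply: eq_bigr => l _; rewrite [B' _ _]mxE (negbTE jk) (negbTE jk').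
Qed.

Lemma exists_coxeter_matroid v w : ble v w ->
  exists Y, [/\ coxeter_matroid Y, v \in Y, w \in Y & Y \subset bruhat_itv v w].
Proof.
case/exists_flag => G [B [Glead Blow Bdiag Hlast]].
(* Among the rows that occur in a relation, the one with the smallest leading position has nothing
   to cancel its leading entry. *)
have Gu : G \in unitmx.
  rewrite -row_free_unit -kermx_eq0; apply: contraT => /rowV0Pn[u /sub_kermxP uG un].
  have [k0 k0n] : exists k, u 0 k != 0.
    by apply/existsP; apply: contraR un => /existsPn H; apply/eqP/rowP => k; rewrite mxE;
      apply/eqP; move: (H k); rewrite negbK.
  case: (@arg_minnP _ k0 (fun k => u 0 k != 0) (fun k => (v^-1)%g k : nat) k0n) => k kN kmin.
  have := congr1 (fun M : 'rV_n => M 0 ((v^-1)%g k)) uG; rewrite /= !mxE (bigD1 k) //= big1.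
    by move/eqP; rewrite addr0 mulf_eq0 (negbTE kN) (negbTE (proj2 (Glead k))).
  move=> j jk; case: (altP (u 0 j =P 0)) => [->|uj]; first by rewrite mul0r.
  rewrite (proj1 (Glead j)) ?mulr0 // ltn_neqAle kmin // andbT.
  by rewrite (inj_eq val_inj) (inj_eq perm_inj) eq_sym.
exists (flag_matroid G).
(* Row [v i] of [G] starts at [i], which bounds the level of [i] by [v i]; a permutation that is
   pointwise at most another equals it. For [w] the rows of [B *m G] are read from the right. *)
have ev : min_perm Gu 1 = v.
  apply: perm_le_eq => i; apply: (@min_perm_le _ Gu _ _ _ (row (v i) 1%:M)).
  - by move=> l il; rewrite !mxE; case: eqP il => // ->; rewrite ltnn.
  - move=> j; rewrite !perm1 -row_mul mul1mx mxE => ji; apply: (proj1 (Glead (v i))).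
    by rewrite permK.
  - by rewrite -row_mul mul1mx mxE; have := proj2 (Glead (v i)); rewrite permK.
have ew : min_perm Gu (rev_perm n)^-1 = w.
  apply: perm_le_eq => i; apply: (@min_perm_le _ Gu _ _ _ (row (w i) B)).
  - by move=> l il; rewrite mxE Blow.
  - move=> j; rewrite rev_permV !permE -row_mul mxE => ji; apply: (proj1 (Hlast (w i))).
    by rewrite permK; move: ji => /=; have := ltn_ord i; have := ltn_ord j; lia.
  - by rewrite -row_mul mxE; have := proj2 (Hlast (w i)); rewrite permK.
split.
- exact: flag_coxeter_matroid.
- by rewrite -ev; exact: min_perm_in.
- by rewrite -ew; exact: min_perm_in.
apply/subsetP => z zY; rewrite inE.
have := min_perm_min Gu 1%g zY; rewrite ev invg1 !mul1g => -> /=.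
by have := min_perm_min Gu (rev_perm n)^-1%g zY; rewrite ew invgK; exact: ble_rev.
Qed.
End FlagMatroid.

(** * Faces of toric intervals *)

Section Toric.
Variables (R : realFieldType) (n : nat).
Implicit Types (x y z u v w s t m a b : 'S_n) (p q i j k : 'I_n) (Y : {set 'S_n}) (c e : 'rV[R]_n).

Definition pdiff x y : 'M[R]_n := perm_mx x - perm_mx y.

Lemma mul_perm_mxE c x k : (c *m perm_mx x) 0 k = c 0 (x^-1 k)%g.
Proof.
rewrite mxE (bigD1 (x^-1 k)%g) //= !mxE permKV eqxx mulr1 big1 ?addr0 // => i ik.
rewrite !mxE; case: eqP => [e|_]; last by rewrite mulr0.
by rewrite -e permK eqxx in ik.
Qed.

Lemma same_levels_pdiff c x y : same_levels c x y = (c *m pdiff x y == 0).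
Proof.
rewrite mulmxBr subr_eq0; apply/same_levelsP/eqP => [H|H k].
  by apply/rowP => k; rewrite !mul_perm_mxE.
by rewrite -!mul_perm_mxE H.
Qed.

Lemma pdiffD x y z : pdiff x z = pdiff x y + pdiff y z.
Proof. by rewrite /pdiff addrA subrK. Qed.

Lemma rank_pdiff_tri y x z : (\rank (pdiff x z) <= \rank (pdiff x y) + \rank (pdiff y z))%N.
Proof. by rewrite (pdiffD x y z); exact: mxrank_add. Qed.

Lemma rank_pdiff_pswap x p q : (\rank (pdiff x (pswap p q x)) <= 1)%N.
Proof.
have [<-|pq] := altP (p =P q).
  by rewrite /pdiff /pswap tperm1 mul1g subrr mxrank0.
have -> : pdiff x (pswap p q x) = (1%:M - perm_mx (tperm p q)) *m perm_mx x.
  by rewrite mulmxBl mul1mx -perm_mxM.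
apply: leq_trans (mxrankM_maxl _ _) _.
have -> : 1%:M - perm_mx (tperm p q) =
    (delta_mx 0 p - delta_mx 0 q : 'rV[R]_n)^T *m (delta_mx 0 p - delta_mx 0 q).
  apply/matrixP => i j; rewrite !mxE big_ord1 !mxE !eqxx /= ![j == _]eq_sym.
  case: tpermP => [->|->|/eqP/negbTE ip /eqP/negbTE iq].
  - by rewrite eqxx (negbTE pq) subr0 mul1r.
  - by rewrite eqxx [q == p]eq_sym (negbTE pq) sub0r mulN1r opprB.
  - by rewrite ip iq !subrr mul0r.
exact: leq_trans (mxrankM_maxr _ _) (rank_leq_row _).
Qed.

Lemma rank_pdiff_le x y : ble x y -> (\rank (pdiff x y) <= ninv y - ninv x)%N.
Proof.
move: x; apply: ble_ind => [|x p q cov le IH]; first by rewrite /pdiff subrr mxrank0.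
apply: leq_trans (rank_pdiff_tri (pswap p q x) _ _) _.
have := rank_pdiff_pswap x p q; have := ble_ninv le; rewrite (ninv_cover cov) in IH *; lia.
Qed.

(* The rank of [pdiff x y] is the absolute length of $x^{-1}y$. *)
Definition toric_rank x y := ble x y && (\rank (pdiff x y) == ninv y - ninv x)%N.

(** Each of the three pieces has rank at most its length, and the lengths add up to the rank of the
    whole, so no bound has slack. *)
Lemma toric_rank_sub v w x y : toric_rank v w -> ble v x -> ble x y -> ble y w -> toric_rank x y.
Proof.
rewrite /toric_rank => /andP[_ /eqP e] vx xy yw; rewrite xy /= eqn_leq rank_pdiff_le //=.
have := rank_pdiff_tri x v w; have := rank_pdiff_tri y x w.
have := rank_pdiff_le vx; have := rank_pdiff_le yw.
have := ble_ninv vx; have := ble_ninv xy; have := ble_ninv yw; rewrite e; lia.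
Qed.

(** The kernels of [A] and [B] meet inside that of [A + B], and additivity of the ranks makes the
    dimensions agree. *)
Lemma rank_add_ker (A B : 'M[R]_n) c : \rank (A + B)%R = (\rank A + \rank B)%N ->
  c *m (A + B) = 0 -> c *m A = 0.
Proof.
move=> e /eqP; rewrite -sub_kermx => cK.
have KAB : (kermx A :&: kermx B <= kermx (A + B))%MS.
  by rewrite sub_kermx mulmxDr (sub_kermxP (capmxSl _ _)) (sub_kermxP (capmxSr _ _)) addr0.
have : (kermx (A + B) <= kermx A :&: kermx B)%MS.
  rewrite -(geq_leqif (mxrank_leqif_sup KAB)).
  have := mxrank_sum_cap (kermx A) (kermx B); have := rank_leq_col (kermx A + kermx B)%MS.
  have := rank_leq_row A; have := rank_leq_row B; have := rank_leq_row (A + B).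
  rewrite !mxrank_ker e; lia.
by rewrite sub_capmx => /andP[h _]; apply/sub_kermxP/(submx_trans cK).
Qed.

(* Ranks add up along $v \le z \le w$, so the kernel of [pdiff v w] lies in that of
   [pdiff v z]. *)
Lemma toric_rank_levels v w c z : toric_rank v w -> same_levels c v w -> z \in bruhat_itv v w ->
  same_levels c v z.
Proof.
move=> tvw; rewrite !same_levels_pdiff (pdiffD v z w) inE => /eqP cvw /andP[vz zw].
apply/eqP/(rank_add_ker _ cvw); rewrite -pdiffD.
have /andP[_ /eqP ->] := tvw.
have /andP[_ /eqP ->] := toric_rank_sub tvw (ble_refl v) vz zw.
have /andP[_ /eqP ->] := toric_rank_sub tvw vz zw (ble_refl w).
by have := ble_ninv vz; have := ble_ninv zw; lia.
Qed.

(** Forms level on [x], [y] fill dimension at least $n-(\ell(y)-\ell(x))$; those level on [v], [w]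
    together with [c] span at most $n-(\ell(w)-\ell(v))+1$. The gap of 2 leaves a form outside the
    latter space. *)
Lemma toric_rank_separate v w x y c : toric_rank v w -> ble x y ->
  (ninv y - ninv x + 2 <= ninv w - ninv v)%N ->
  exists e, same_levels e x y /\ forall l, ~~ same_levels (e - l *: c) v w.
Proof.
case/andP=> _ /eqP evw xy le.
have : ~~ (kermx (pdiff x y) <= kermx (pdiff v w) + c)%MS.
  apply/negP => /mxrankS; rewrite mxrank_ker => h.
  have := leq_trans h (mxrank_adds_leqif _ _); rewrite mxrank_ker evw.
  have := rank_pdiff_le xy; have := rank_leq_row c; have := rank_leq_row (pdiff v w).
  by rewrite evw; lia.
case/row_subPn => i ni; exists (row i (kermx (pdiff x y))); split.
  by rewrite same_levels_pdiff -row_mul mulmx_ker row0.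
move=> l; apply: contra ni; rewrite same_levels_pdiff -sub_kermx => h.
rewrite -[row i _](subrK (l *: c)); apply: addmx_sub_adds => //; exact: scalemx_sub.
Qed.

Lemma toric_rank_nonconstant v w : toric_rank v w -> (ninv v < ninv w)%N ->
  exists c, ~~ same_levels c v w.
Proof.
case/andP=> _ /eqP evw lt.
have : ~~ ((1%:M : 'M[R]_n) <= kermx (pdiff v w))%MS.
  rewrite sub_kermx mul1mx; apply/eqP => e; move: evw; rewrite e mxrank0; lia.
by case/row_subPn => i ni; exists (row i 1%:M); rewrite same_levels_pdiff -sub_kermx.
Qed.

Lemma lvalB c e l z : lval (c - l *: e) z = lval c z - l * lval e z.
Proof.
by rewrite /lval mulr_sumr -sumrB; apply: eq_bigr => i _; rewrite !mxE mulrBl mulrA.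
Qed.

Lemma lvalZD l c e z : lval (l *: c + e) z = l * lval c z + lval e z.
Proof.
by rewrite /lval mulr_sumr -big_split; apply: eq_bigr => i _; rewrite !mxE /= mulrDl mulrA.
Qed.

Lemma maxset_sub c Y : maxset c Y \subset Y.
Proof. by apply/subsetP => z; rewrite inE => /andP[]. Qed.

Lemma maxset_le c Y x z : x \in maxset c Y -> z \in Y -> lval c z <= lval c x.
Proof. by rewrite inE => /andP[_ /forall_inP]; apply. Qed.

Lemma maxset_eq c Y x z : x \in maxset c Y -> z \in Y ->
  (z \in maxset c Y) = (lval c x <= lval c z).
Proof.
move=> xM zY; rewrite inE zY /=; apply/forall_inP/idP => [|le y yY].
  by apply; apply: (subsetP (maxset_sub c Y)).
exact: le_trans (maxset_le xM yY) le.
Qed.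

Lemma maxset_neq0 c Y z : z \in Y -> exists x, x \in maxset c Y.
Proof.
move=> zY; case: (@Order.TotalTheory.arg_maxP _ _ _ z (mem Y) (lval c) zY) => x xY xm.
by exists x; rewrite inE; apply/andP; split=> //; apply/forall_inP => y yY; exact: xm.
Qed.

(* The hyperplane [c] is rotated about the face in the direction [e] until it hits
   a new vertex; the angle [l] is found by the minimum ratio test. *)
Lemma pivot c e Y x : x \in maxset c Y ->
  {in maxset c Y, forall z, lval e z = lval e x} ->
  (exists2 z, z \in Y & lval e z < lval e x) ->
  exists l, let M := maxset (c - l *: e) Y in
  [/\ maxset c Y \subset M, exists2 z, z \in M & lval e z < lval e x &
      forall z, z \in M -> z \notin maxset c Y -> lval e z < lval e x].
Proof.
move=> xM ec [z0 z0Y z0e].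
pose S := [pred z | (z \in Y) && (lval e z < lval e x)].
have Sz0 : S z0 by rewrite /S /= z0Y.
(* [f z] is the value of [l] at which [z] ties with [x] under [c - l *: e]. *)
pose f z := (lval c x - lval c z) / (lval e x - lval e z).
case: (@Order.TotalTheory.arg_minP _ _ _ z0 S f Sz0) => z1 /andP[z1Y z1e] z1min.
have xY := subsetP (maxset_sub c Y) _ xM.
have cM z : z \in Y -> z \notin maxset c Y -> lval c z < lval c x.
  by move=> zY; rewrite (maxset_eq xM zY) -ltNge.
have nS z : z \in Y -> lval e z < lval e x -> lval c z < lval c x.
  by move=> zY ze; apply: cM => //; apply: contraL ze => /ec ->; rewrite ltxx.
exists (f z1) => /=; set M := maxset (c - f z1 *: e) Y.
have d z : lval (c - f z1 *: e) x - lval (c - f z1 *: e) z =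
    (lval c x - lval c z) - f z1 * (lval e x - lval e z) by rewrite !lvalB; ring.
have f0 : 0 < f z1 by rewrite divr_gt0 ?subr_gt0 // nS.
have xM' : x \in M.
  rewrite inE xY; apply/forall_inP => z zY; rewrite -subr_ge0 d.
  case: (ltP (lval e z) (lval e x)) => ze.
    by rewrite subr_ge0 -ler_pdivlMr ?subr_gt0 //; apply: z1min; rewrite /S /= zY.
  rewrite subr_ge0; apply: (@le_trans _ _ 0); last by rewrite subr_ge0 (maxset_le xM).
  by rewrite pmulr_rle0 // subr_le0.
have inM z : z \in Y -> (z \in M) = ((lval c x - lval c z) <= f z1 * (lval e x - lval e z)).
  by move=> zY; rewrite (maxset_eq xM' zY) -subr_le0 d subr_le0.
split.
- apply/subsetP => z zM; have zY := subsetP (maxset_sub c Y) _ zM.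
  by rewrite inM // ec // subrr mulr0 subr_le0 (maxset_le zM).
- by exists z1 => //; rewrite inM // /f mulfVK // subr_eq0 gt_eqF.
move=> z zM zn; have zY := subsetP (maxset_sub _ Y) _ zM; move: zM; rewrite inM // => le.
have := lt_le_trans (_ : 0 < lval c x - lval c z) le; rewrite subr_gt0 => /(_ (cM _ zY zn)).
by rewrite pmulr_rgt0 // subr_gt0.
Qed.

(** A face of a face is a face: a large multiple of [c] plus [e] maximizes lexicographically. The
    factor [C] exceeds every ratio of a possible gain in [e] to the loss in [c]. *)
Lemma maxset_maxset c e Y : exists c', maxset c' Y = maxset e (maxset c Y).
Proof.
case: (set_0Vmem Y) => [->|[y0 y0Y]].
  by exists 0; apply/setP => z; rewrite !inE.
have [x0 x0M] := maxset_neq0 c y0Y; have [x xM] := maxset_neq0 e x0M.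
have xM1 := subsetP (maxset_sub e _) _ xM; have xY := subsetP (maxset_sub c Y) _ xM1.
pose C := 1 + \sum_(z in Y :\: maxset c Y) `|lval e x - lval e z| / (lval c x - lval c z).
have d z : lval (C *: c + e) x - lval (C *: c + e) z =
    C * (lval c x - lval c z) + (lval e x - lval e z) by rewrite !lvalZD; ring.
have cM z : z \in Y -> z \notin maxset c Y -> lval c z < lval c x.
  by move=> zY; rewrite (maxset_eq xM1 zY) -ltNge.
have big z : z \in Y -> z \notin maxset c Y -> 0 < lval (C *: c + e) x - lval (C *: c + e) z.
  move=> zY zn; have cz : 0 < lval c x - lval c z by rewrite subr_gt0 cM.
  have le : `|lval e x - lval e z| < C * (lval c x - lval c z).
    rewrite -ltr_pdivrMr // /C (bigD1 z) /=; last by rewrite in_setD zn.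
    set S := \sum_(_ | _) _; have : 0 <= S.
      apply: sumr_ge0 => y; rewrite in_setD => /andP[/andP[yn yY] _].
      by rewrite divr_ge0 // subr_ge0 ltW // cM.
    by lra.
  by rewrite d; have := ler_norm (- (lval e x - lval e z)); rewrite normrN; lra.
have dM z : z \in maxset c Y -> lval (C *: c + e) x - lval (C *: c + e) z = lval e x - lval e z.
  move=> zM; have zY := subsetP (maxset_sub c Y) _ zM.
  by rewrite d; have -> : lval c x = lval c z; [apply/eqP;
    rewrite eq_le (maxset_le zM) // (maxset_le xM1) | rewrite subrr mulr0 add0r].
exists (C *: c + e).
have xM' : x \in maxset (C *: c + e) Y.
  rewrite inE xY; apply/forall_inP => z zY; rewrite -subr_ge0.
  case: (boolP (z \in maxset c Y)) => zM; last exact/ltW/big.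
  by rewrite dM // subr_ge0 (maxset_le xM).
apply/setP => z; case: (boolP (z \in Y)) => zY; last first.
  by rewrite !inE (negbTE zY).
rewrite (maxset_eq xM' zY) -subr_le0; case: (boolP (z \in maxset c Y)) => zM.
  by rewrite dM // subr_le0 (maxset_eq xM zM).
have := big z zY zM; rewrite ltNge => /negbTE ->.
by apply/esym/negbTE; apply: contra zM; exact/subsetP/maxset_sub.
Qed.

End Toric.

(** * Induction on the length of a toric interval *)

Section Faces.
Variables (R : realFieldType) (n : nat).
Implicit Types (x y z u v w s t m a b : 'S_n) (p q i j k : 'I_n) (Y : {set 'S_n}) (c e : 'rV[R]_n).

(** The first clause covers all Coxeter matroids, since a face of one is at first known only as a
    Coxeter matroid; it identifies such faces with intervals. The second supplies the smaller faces
    about which hyperplanes rotate. *)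
Definition interval_faces v w :=
  (forall Y, coxeter_matroid Y -> v \in Y -> w \in Y -> Y \subset bruhat_itv v w ->
    Y = bruhat_itv v w) /\
  (forall x y, ble v x -> ble x y -> ble y w ->
    exists c, maxset c (bruhat_itv v w) = bruhat_itv x y).

Lemma bruhat_itvL x y : ble x y -> x \in bruhat_itv x y. Proof. by rewrite inE ble_refl. Qed.
Lemma bruhat_itvR x y : ble x y -> y \in bruhat_itv x y. Proof. by rewrite inE ble_refl andbT. Qed.

Section Step.
Variables (v w : 'S_n) (Y : {set 'S_n}).
Hypotheses (tvw : toric_rank R v w) (cY : coxeter_matroid Y) (vY : v \in Y) (wY :
  w \in Y) (Yvw : Y \subset bruhat_itv v w).
Hypothesis IH : forall x y, toric_rank R x y -> (ninv y - ninv x < ninv w - ninv v)%N ->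
  interval_faces x y.

Let vw : ble v w. Proof. by case/andP: tvw. Qed.

Definition face x y := exists c, maxset c Y = bruhat_itv x y.

Lemma face_const c : same_levels c v w -> maxset c Y = Y.
Proof.
move=> cvw; apply/setP => z; rewrite inE; case: (boolP (z \in Y)) => // zY.
apply/forall_inP => y yY.
have H u : u \in Y -> lval c u = lval c v.
  by move=> uY; apply/esym/same_levels_lval/(toric_rank_levels tvw cvw)/(subsetP Yvw).
by rewrite !H.
Qed.

(** If the minimum and maximum of the face were [v] and [w], both would maximize [c] and so be
    level. *)
Lemma proper_face c : ~~ same_levels c v w -> exists x y,
  [/\ ble v x, ble x y, ble y w,
    (ninv y - ninv x < ninv w - ninv v)%N & maxset c Y = bruhat_itv x y].
Proof.
move=> ncvw; have [cM cc] := coxeter_matroid_face c cY.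
have [x [y [xM yM Mxy]]] := coxeter_matroid_minmax cM.
have /andP[vx xw] : ble v x && ble x w.
  by have := subsetP Yvw x (subsetP (maxset_sub c Y) _ xM); rewrite inE.
have /andP[vy yw] : ble v y && ble y w.
  by have := subsetP Yvw y (subsetP (maxset_sub c Y) _ yM); rewrite inE.
have xy : ble x y by have := subsetP Mxy _ xM; rewrite inE => /andP[].
have lt : (ninv y - ninv x < ninv w - ninv v)%N.
  have n1 := ble_ninv vx; have n2 := ble_ninv yw; have n3 := ble_ninv xy.
  rewrite ltnNge; apply: contra ncvw => le.
  have ex : v = x by apply: (ble_ninv_eq vx); nlia.
  have ey : y = w by apply: (ble_ninv_eq yw); nlia.
  by apply: cc; rewrite ?ex // -ey.
exists x, y; split=> //.
have [+ _] := IH (toric_rank_sub tvw vx xy yw) lt; exact.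
Qed.

Lemma sub_face x y x' y' : face x y -> ble v x -> ble x x' -> ble x' y' -> ble y' y -> ble y w ->
  (ninv y - ninv x < ninv w - ninv v)%N -> face x' y'.
Proof.
case=> c Mc vx xx' xy' yy' yw lt.
have xy : ble x y := ble_trans xx' (ble_trans xy' yy').
have [_ /(_ x' y' xx' xy' yy')[e Me]] := IH (toric_rank_sub tvw vx xy yw) lt.
by have [c' Mc'] := maxset_maxset c e Y; exists c'; rewrite Mc' Mc.
Qed.

(* Here [face x'' y''] is reached from the smaller face [x', y'] by moving away from
   the face [x, y]. *)
Lemma adjacent_face x y x' y' : face x y -> ble v x -> ble x x' -> ble x' y' -> ble y' y ->
  ble y w -> (ninv y - ninv x < ninv w - ninv v)%N -> (x', y') != (x, y) ->
  exists x'' y'', [/\ face x'' y'', ble v x'' && ble x'' x', ble y' y'' && ble y'' w,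
    (ninv y'' - ninv x'' < ninv w - ninv v)%N &
    (exists2 z, z \in bruhat_itv x'' y'' & z \notin bruhat_itv x y) /\
    (forall z, z \in bruhat_itv x'' y'' -> z \in bruhat_itv x y -> z \in bruhat_itv x' y')].
Proof.
move=> fxy vx xx' xy' yy' yw lt neq; have [e Me] := fxy.
have [c Mc] := sub_face fxy vx xx' xy' yy' yw lt.
have xy : ble x y := ble_trans xx' (ble_trans xy' yy').
have sub : bruhat_itv x' y' \subset bruhat_itv x y.
  apply/subsetP => z; rewrite !inE => /andP[a b].
  by rewrite (ble_trans xx' a) (ble_trans b yy').
have x'M : x' \in maxset c Y by rewrite Mc bruhat_itvL.
have x'Me : x' \in maxset e Y by rewrite Me (subsetP sub) // bruhat_itvL.
have eE z : z \in maxset e Y -> lval e z = lval e x'.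
  move=> zM; apply/eqP; rewrite eq_le (maxset_le x'Me) ?(subsetP (maxset_sub e Y)) //.
  by rewrite (maxset_le zM) // (subsetP (maxset_sub c Y)).
have outM z : z \in Y -> z \notin bruhat_itv x y -> lval e z < lval e x'.
  by move=> zY; rewrite -Me (maxset_eq x'Me zY) -ltNge.
have nin z : lval e z < lval e x' -> z \notin bruhat_itv x y.
  by apply: contraL; rewrite -Me => /eE ->; rewrite ltxx.
have [z0 z0Y z0n] : exists2 z, z \in Y & z \notin bruhat_itv x y.
  case: (boolP (v \in bruhat_itv x y)) => hv; last by exists v.
  case: (boolP (w \in bruhat_itv x y)) => hw; last by exists w.
  move: hv hw; rewrite !inE => /andP[xv _] /andP[_ wy].
  by have := ble_ninv xv; have := ble_ninv wy; nlia.
(* The form [c] of the small face is tilted against [e], which is maximal on [Y] exactly along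
   [[x, y]]; every point gained therefore lies outside [[x, y]]. *)
have [||l [MM [z1 z1M z1e] outer]] := @pivot _ _ c e Y x' x'M.
- by move=> z; rewrite Mc => /(subsetP sub); rewrite -Me; exact: eE.
- by exists z0 => //; exact: outM.
(* Otherwise the new face is all of [Y], and [[x, y]], which gains no point, already equals
   [[x', y']]. *)
have nc : ~~ same_levels (c - l *: e) v w.
  apply/negP => /face_const MY; rewrite MY in outer.
  have H z : z \in bruhat_itv x y -> z \in bruhat_itv x' y'.
    move=> zxy; apply: contraT => zn; have zM : z \in maxset e Y by rewrite Me.
    have := outer z (subsetP (maxset_sub e Y) _ zM); rewrite Mc => /(_ zn).
    by rewrite eE // ltxx.
  have := H x (bruhat_itvL xy); have := H y (bruhat_itvR xy); rewrite !inE => /andP[_ a] /andP[b _].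
  by case/eqP: neq; congr (_, _); apply: ble_anti.
have [x'' [y'' [vx'' xy'' yw'' lt'' MM']]] := proper_face nc.
rewrite MM' Mc in MM z1M outer.
have := subsetP MM _ (bruhat_itvL xy'); have := subsetP MM _ (bruhat_itvR xy').
rewrite !inE => /andP[_ yy''] /andP[xx'' _].
exists x'', y''; rewrite vx'' xx'' yy'' yw''; split=> //; first by exists (c - l *: e).
split; first by exists z1 => //; exact: nin.
move=> z zM zxy; apply: contraT => zn; have := outer z zM zn.
by rewrite -Me in zxy; rewrite eE // ltxx.
Qed.

Definition atom a := [&& ble v a, ble a w & ninv a == (ninv v).+1].
Definition coatom b := [&& ble v b, ble b w & (ninv b).+1 == ninv w].

(** Rotate about [[a, b]] away from [[a, w]]. By length the new face starts at [v] or [a] and ends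
    at [b] or [w]. Ending at [w] would put [w] into [[a, b]], and starting at [a] would not leave
    [[a, w]]; so it is [[v, b]]. The converse is symmetric. *)
Lemma atom_coatom_face a b : atom a -> coatom b -> ble a b -> (face a w <-> face v b).
Proof.
case/and3P => va aw /eqP na /and3P[vb bw /eqP nb] ab.
have n1 := ble_ninv ab.
split=> f.
  have [||x [y [fxy /andP[vx xa] /andP[b_y yw] lt [[z zM zn] H]]]] :=
      adjacent_face f va (ble_refl a) ab bw (ble_refl w).
  - nlia.
  - by apply/eqP => -[e]; move: nb; rewrite e; nlia.
  have xy : ble x y := ble_trans xa (ble_trans ab b_y).
  have ey : y = b.
    apply/esym/(ble_ninv_eq b_y); have := ble_ninv yw; have := ble_ninv b_y.
    case: (altP (y =P w)) => [e|ne]; last by have := ble_ninv_lt yw ne; nlia.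
    have : w \in bruhat_itv a b by apply: H; rewrite ?bruhat_itvR // -e bruhat_itvR.
    by rewrite inE => /andP[_ /ble_ninv]; nlia.
  have ex : x = v.
    apply/esym/(ble_ninv_eq vx); have := ble_ninv xa.
    case: (altP (x =P a)) => [e|ne]; last by have := ble_ninv_lt xa ne; nlia.
    case/negP: zn; move: zM; rewrite !inE e => /andP[-> zy].
    exact: ble_trans zy yw.
  by rewrite -ex -ey.
have [||x [y [fxy /andP[vx xa] /andP[b_y yw] lt [[z zM zn] H]]]] :=
    adjacent_face f (ble_refl v) va ab (ble_refl b) bw.
- nlia.
- by apply/eqP => -[e]; move: na; rewrite e; nlia.
have xy : ble x y := ble_trans xa (ble_trans ab b_y).
have ex : x = a.
  apply: (ble_ninv_eq xa); have := ble_ninv vx; have := ble_ninv xa.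
  case: (altP (v =P x)) => [e|ne]; last by have := ble_ninv_lt vx ne; nlia.
  have : v \in bruhat_itv a b by apply: H; rewrite ?bruhat_itvL // e bruhat_itvL.
  by rewrite inE => /andP[/ble_ninv]; nlia.
have ey : y = w.
  apply: (ble_ninv_eq yw); have := ble_ninv b_y.
  case: (altP (b =P y)) => [e|ne]; last by have := ble_ninv_lt b_y ne; nlia.
  case/negP: zn; move: zM; rewrite !inE -e => /andP[xz ->]; rewrite andbT.
  exact: ble_trans vx xz.
by rewrite -ex -ey.
Qed.

(** A proper face of codimension at least 2 grows: rotate its form in a direction constant on the
    face, chosen so that no rotated form is constant on $[v,w]$. *)
Lemma exists_facet : (ninv v < ninv w)%N -> exists c x y,
  [/\ ~~ same_levels c v w, maxset c Y = bruhat_itv x y, [&& ble v x, ble x y & ble y w] &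
      (ninv y - ninv x).+1 = (ninv w - ninv v)%N].
Proof.
move=> lt.
suff H d : (d < ninv w - ninv v)%N -> exists c x y,
  [/\ ~~ same_levels c v w, maxset c Y = bruhat_itv x y, [&& ble v x, ble x y & ble y w] &
      (d <= ninv y - ninv x < ninv w - ninv v)%N].
  have [|c [x [y [nc Mc le rk]]]] := H (ninv w - ninv v).-1%N; first nlia.
  by exists c, x, y; split=> //; nlia.
elim: d => [_|d IHd ltd].
  have [c nc] := toric_rank_nonconstant tvw lt; have [x [y [vx xy yw lxy Mc]]] := proper_face nc.
  by exists c, x, y; rewrite vx xy yw lxy leq0n.
have [|c [x [y [nc Mc /and3P[vx xy yw] /andP[le ltxy]]]]] := IHd; first exact: ltnW.
case: (ltngtP d (ninv y - ninv x)%N) => [lt'|lt'|ed]; last 1 first.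
- have [|e [exy ne]] := @toric_rank_separate R n v w x y c tvw xy; first by nlia.
  have xM : x \in maxset c Y by rewrite Mc bruhat_itvL.
  have econst z : z \in maxset c Y -> lval e z = lval e x.
    rewrite Mc => zM; apply/esym/same_levels_lval/(toric_rank_levels _ exy zM).
    exact: toric_rank_sub tvw vx xy yw.
  have ne0 : ~~ same_levels e v w by have := ne 0; rewrite scale0r subr0.
  have [e' [e'M [z zY ze] ne']] : exists e', [/\ {in maxset c Y, forall z, lval e' z = lval e' x},
      exists2 z, z \in Y & lval e' z < lval e' x & forall l, ~~ same_levels (c - l *: e') v w].
    (* Separation concerns [e - l *: c]; scaling exchanges the two forms for nonzero [l], and
       [l = 0] is the form [c] itself. *)
    have nl l : ~~ same_levels (c - l *: e) v w.
      case: (altP (l =P 0)) => [->|l0]; first by rewrite scale0r subr0.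
      have := ne l^-1; apply: contra => /same_levelsP H; apply/same_levelsP => k.
      have := H k; rewrite !mxE => h; apply: (mulfI l0).
      by rewrite !mulrBr !mulrA mulfV // !mul1r -opprB h opprB.
    (* If [e] were constant on [Y], both [v] and [w] would maximize it and so be level. The sign of
       [e] is then chosen so that it drops at [z]. *)
    have [z zY zx] : exists2 z, z \in Y & lval e z != lval e x.
      apply/exists_inP; apply: contraT => /exists_inPn H; case/negP: ne0.
      have [_ cc] := coxeter_matroid_face e cY; apply: cc.
        by rewrite inE vY; apply/forall_inP => y' y'Y; move: (H _ y'Y) (H _ vY);
          rewrite !negbK => /eqP -> /eqP ->.
      by rewrite inE wY; apply/forall_inP => y' y'Y; move: (H _ y'Y) (H _ wY);
        rewrite !negbK => /eqP -> /eqP ->.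
    move: zx; rewrite neq_lt => /orP[zx|zx]; first by exists e; split=> //; exists z.
    have eN u : lval (- e) u = - lval e u.
      by rewrite /lval -sumrN; apply: eq_bigr => i _; rewrite mxE mulNr.
    exists (- e); split=> [u uM||l]; first by rewrite !eN econst.
      by exists z => //; rewrite !eN ltrN2.
    by rewrite scalerN -scaleNr; exact: nl.
  have [|l [MM [z1 z1M z1e] _]] := pivot xM e'M; first by exists z.
  have [x' [y' [vx' xy' yw' lt' Mc']]] := proper_face (ne' l).
  exists (c - l *: e'), x', y'; rewrite vx' xy' yw' lt' andbT; split=> //.
  rewrite Mc Mc' in MM; rewrite Mc' in z1M.
  have := subsetP MM _ (bruhat_itvL xy); have := subsetP MM _ (bruhat_itvR xy).
  rewrite !inE => /andP[_ yy'] /andP[x'x _]; rewrite ed.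
  have n1 := ble_ninv yy'; have n2 := ble_ninv x'x; have n3 := ble_ninv xy.
  rewrite ltnNge; apply/negP => le'.
  have ey : y = y' by apply: ble_ninv_eq yy' _; nlia.
  have ex : x' = x by apply: ble_ninv_eq x'x _; nlia.
  by move: z1e; rewrite e'M ?ltxx // Mc -ex ey.
- by exists c, x, y; rewrite vx xy yw ltxy lt'.
- by nlia.
Qed.

Lemma all_facets : (ninv v < ninv w)%N ->
  (forall a, atom a -> face a w) /\ (forall b, coatom b -> face v b).
Proof.
move=> lt; have [c [x [y [nc Mc /and3P[vx xy yw] rk]]]] := exists_facet lt.
have n1 := ble_ninv vx; have n2 := ble_ninv xy; have n3 := ble_ninv yw.
(* In length 1 the facets are the two vertices, exposed by [c] and [- c]. *)
case: (ltnP (ninv v).+1 (ninv w)) => d2; last first.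
  have cM : face v v /\ face w w.
    have eN u : lval (- c) u = - lval c u.
      by rewrite /lval -sumrN; apply: eq_bigr => i _; rewrite mxE mulNr.
    have nc' : ~~ same_levels (- c) v w.
      by apply: contra nc => /same_levelsP H; apply/same_levelsP => k; have := H k;
        rewrite !mxE => /oppr_inj.
    have [x' [y' [vx' xy' yw' lt' Mc']]] := proper_face nc'.
    have n1' := ble_ninv vx'; have n2' := ble_ninv xy'; have n3' := ble_ninv yw'.
    have exy : x = y by apply: (ble_ninv_eq xy); nlia.
    have exy' : x' = y' by apply: ble_ninv_eq xy' _; nlia.
    have alt u : ble v u -> ble u w -> u = v \/ u = w.
      move=> vu uw; have := ble_ninv vu; have := ble_ninv uw.
      case: (leqP (ninv u) (ninv v)) => h; first by left; apply/esym/(ble_ninv_eq vu).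
      by move=> _ _; right; apply: (ble_ninv_eq uw); nlia.
    have xnx : x != x'.
      apply: contraNneq nc => e; have xM : x \in maxset c Y by rewrite Mc bruhat_itvL.
      have xM' : x \in maxset (- c) Y by rewrite Mc' e bruhat_itvL.
      have [_ cc] := coxeter_matroid_face c cY; apply: cc; rewrite (maxset_eq xM) //.
        by have := maxset_le xM' vY; rewrite !eN lerN2.
      by have := maxset_le xM' wY; rewrite !eN lerN2.
    have xw : ble x w := ble_trans xy yw; have xw' : ble x' w := ble_trans xy' yw'.
    case: (alt x vx xw) => ex; case: (alt x' vx' xw') => ex'.
    - by rewrite ex ex' eqxx in xnx.
    - by split; [exists c; rewrite Mc -exy ex | exists (- c); rewrite Mc' -exy' ex'].
    - by split; [exists (- c); rewrite Mc' -exy' ex' | exists c; rewrite Mc -exy ex].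
    - by rewrite ex ex' eqxx in xnx.
  split=> [a /and3P[va aw /eqP na]|b /and3P[vb bw /eqP nb]].
    by have -> : a = w by [apply: (ble_ninv_eq aw); rewrite na]; case: cM.
  by have <- : v = b by [apply: (ble_ninv_eq vb); nlia]; case: cM.
(* [Q z] says that all candidate facets containing [z] are faces. Rotation about ridges makes it
   constant along comparable elements, and the one facet found above starts it. *)
pose Q z := (forall a, atom a -> ble a z -> face a w) /\
            (forall b, coatom b -> ble z b -> face v b).
have Qle z z' : open_itv v w z -> open_itv v w z' -> ble z z' -> (Q z <-> Q z').
  move=> oz oz' zz'; split=> -[Q1 Q2]; split.
  - move=> a ha az'; case/and4P: (oz') => vz' zw' _ nz'.
    have [b [zb bw nb]] := ble_coatom zw' nz'.
    have cb : coatom b by rewrite /coatom (ble_trans vz' zb) bw nb eqxx.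
    by apply/(atom_coatom_face ha cb (ble_trans az' zb)); apply: Q2 => //; exact: ble_trans zb.
  - by move=> b cb zb; apply: Q2 => //; exact: ble_trans zb.
  - by move=> a ha az; apply: Q1 => //; exact: ble_trans zz'.
  - move=> b hb zb; case/and4P: (oz) => vz zw nz _.
    have nz' : v != z by rewrite eq_sym.
    have [a [va az na]] := ble_atom vz nz'.
    have ca : atom a by rewrite /atom va (ble_trans az zw) na eqxx.
    by apply/(atom_coatom_face ca hb (ble_trans az zb)); apply: Q1 => //; exact: ble_trans zz'.
have Qof z0 : open_itv v w z0 ->
  ninv z0 = (ninv v).+1 /\ face z0 w \/ (ninv z0).+1 = ninv w /\ face v z0 -> Q z0.
  move=> oz0; case/and4P: (oz0) => vz zw _ _ [] [nz fz].
    have az : atom z0 by rewrite /atom vz zw nz eqxx.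
    split=> [a /and3P[va aw /eqP na] az0|b cb zb]; last by apply/(atom_coatom_face az cb zb).
    by rewrite (ble_ninv_eq az0) // nz na.
  have cz : coatom z0 by rewrite /coatom vz zw nz eqxx.
  split=> [a ha az|b /and3P[vb bw /eqP nb] zb]; first by apply/(atom_coatom_face ha cz az).
  by rewrite -(ble_ninv_eq zb) //; nlia.
have [z0 [oz0 Qz0]] : exists z0, open_itv v w z0 /\ Q z0.
  case: (leqP (ninv x) (ninv v)) => h.
    have ex : v = x := ble_ninv_eq vx h.
    have oy : open_itv v w y by apply: open_itvI => //; [rewrite ex | nlia].
    exists y; split=> //; apply: Qof => //; right; split; first by nlia.
    by exists c; rewrite ex.
  have ey : y = w by apply: (ble_ninv_eq yw); nlia.
  have ox : open_itv v w x by apply: open_itvI => //; [rewrite -ey | nlia].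
  exists x; split=> //; apply: Qof => //; left; split; first by nlia.
  by exists c; rewrite -ey.
have Qall z : open_itv v w z -> Q z.
  move=> oz; case: (ltnP (ninv v + 2) (ninv w)) => d3.
    have d3' : (ninv v + 3 <= ninv w)%N by nlia.
    by apply/(open_itv_conn vw d3' Qle oz oz0).
  (* Length 2: the open interval is not connected. Rotating the edge [[v, z0]] about the vertex [v]
     gives an edge to another middle element, which by thinness is [z]. *)
  have e2 : ninv w = (ninv v + 2)%N by nlia.
  case: (altP (z =P z0)) => [->//|zz0].
  have nz0 : ninv z0 = (ninv v).+1 by have := open_itv_ninv oz0; nlia.
  have nz : ninv z = (ninv v).+1 by have := open_itv_ninv oz; nlia.
  case/and4P: (oz0) => vz0 z0w _ _; case/and4P: (oz) => vz zw _ _.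
  have cz0 : coatom z0 by rewrite /coatom vz0 z0w nz0 e2; nlia.
  have fz0 : face v z0 by case: Qz0 => _; apply=> //; exact: ble_refl.
  have [||x' [y' [fxy /andP[vx' xv] /andP[vy yw'] lt' [[u uM un] H]]]] :=
      adjacent_face fz0 (ble_refl v) (ble_refl v) (ble_refl v) vz0 z0w.
  - nlia.
  - by apply/eqP => -[e]; move: nz0; rewrite e; nlia.
  have ex' : x' = v by apply: ble_anti.
  have oy : open_itv v w y'.
    apply: open_itvI => //; apply/andP; split; last by rewrite ex' in lt'; nlia.
    apply: ble_ninv_lt => //; apply: contraNneq un => e; move: uM.
    by rewrite ex' -e !inE => /andP[-> uv]; exact: ble_trans vz0.
  have yz : y' = z.
    case: (open_itv_thin vw e2 oz oz0 oy zz0) => // e.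
    by case/negP: un; rewrite -ex' -e.
  by apply: Qof => //; right; split; [nlia | rewrite -yz -[v in face v]ex'].
split=> [a ha|b hb].
  have /and3P[va aw /eqP na] := ha.
  have [+ _] : Q a by apply: Qall; apply: open_itvI => //; nlia.
  by apply=> //; exact: ble_refl.
have /and3P[vb bw /eqP nb] := hb.
have [_ +] : Q b by apply: Qall; apply: open_itvI => //; nlia.
by apply=> //; exact: ble_refl.
Qed.

(** Every element other than [w] lies below a coatom [b], hence in the face [[v, b]] of [Y]. Smaller
    intervals are faces of facets. *)
Lemma step_interval_faces : Y = bruhat_itv v w /\
  (forall x y, ble v x -> ble x y -> ble y w -> exists c, maxset c Y = bruhat_itv x y).
Proof.
case: (ltnP (ninv v) (ninv w)) => lt; last first.
  have e : v = w := ble_ninv_eq vw lt.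
  have eY : Y = bruhat_itv v w.
    apply/eqP; rewrite eqEsubset Yvw; apply/subsetP => z; rewrite inE -e => /andP[a b].
    by rewrite -(ble_anti a b).
  split=> // x y vx xy yw; exists 0; rewrite face_const; last by rewrite e same_levels_refl.
  have <- : v = x by apply: (ble_anti vx); rewrite e; exact: ble_trans yw.
  by rewrite (ble_anti yw) // -e (ble_trans vx).
have [fa fc] := all_facets lt.
have eY : Y = bruhat_itv v w.
  apply/eqP; rewrite eqEsubset Yvw; apply/subsetP => z; rewrite inE => /andP[vz zw].
  case: (altP (z =P w)) => [->//|nz]; have [b [zb bw nb]] := ble_coatom zw nz.
  have cb : coatom b by rewrite /coatom (ble_trans vz zb) bw nb eqxx.
  have [c Mc] := fc b cb; apply: (subsetP (maxset_sub c Y)).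
  by rewrite Mc inE vz.
split=> // x y vx xy yw.
case: (altP (y =P w)) => [ey|ny].
  case: (altP (v =P x)) => [ex|nx].
    exists 0; rewrite face_const; first by rewrite -ex ey.
    by apply/same_levelsP => k; rewrite !mxE.
  have [a [va ax na]] := ble_atom vx nx.
  have aw : ble a w := ble_trans ax (ble_trans xy yw).
  have ca : atom a by rewrite /atom va aw na eqxx.
  apply: (sub_face (fa a ca) va ax xy yw (ble_refl w)).
  by rewrite na; nlia.
have [b [yb bw nb]] := ble_coatom yw ny.
have vb : ble v b := ble_trans vx (ble_trans xy yb).
have cb : coatom b by rewrite /coatom vb bw nb eqxx.
apply: (sub_face (fc b cb) (ble_refl v) vx xy yb bw).
by nlia.
Qed.

End Step.

(** The second clause needs some Coxeter matroid to start from; the flag provides it, and the first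
    clause identifies it with the interval. *)
Lemma toric_rank_faces v w : toric_rank R v w -> interval_faces v w.
Proof.
have [d] := ubnP (ninv w - ninv v); elim: d v w => // d IHd v w; rewrite ltnS => hd tvw.
have IH x y : toric_rank R x y -> (ninv y - ninv x < ninv w - ninv v)%N -> interval_faces x y.
  by move=> txy lt; apply: IHd => //; nlia.
split=> [Y cY vY wY Yvw|x y vx xy yw]; first by have [] := step_interval_faces tvw cY vY wY Yvw IH.
have vw : ble v w by case/andP: tvw.
have [Y [cY vY wY Yvw]] := exists_coxeter_matroid R vw.
by have [<- ] := step_interval_faces tvw cY vY wY Yvw IH; apply.
Qed.

Lemma toric_rank_maxset v w c : toric_rank R v w -> exists x y,
  [/\ ble v x, ble x y, ble y w & maxset c (bruhat_itv v w) = bruhat_itv x y].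
Proof.
move=> tvw; have vw : ble v w by case/andP: tvw.
have [Y [cY vY wY Yvw]] := exists_coxeter_matroid R vw.
have [full1 _] := toric_rank_faces tvw; have eY := full1 Y cY vY wY Yvw; rewrite eY in cY.
have [cM _] := coxeter_matroid_face c cY; have [x [y [xM yM Mxy]]] := coxeter_matroid_minmax cM.
have := subsetP (maxset_sub c _) _ xM; have := subsetP (maxset_sub c _) _ yM.
rewrite !inE => /andP[vy yw] /andP[vx xw].
have xy : ble x y by have := subsetP Mxy _ xM; rewrite inE => /andP[].
exists x, y; split=> //.
have [full2 _] := toric_rank_faces (toric_rank_sub tvw vx xy yw); exact: full2.
Qed.

End Faces.

(** * Maximal chains and dimension *)

Section Chains.
Variables (R : realFieldType) (n : nat).
Implicit Types (x y z u v w s t m a b : 'S_n) (p q i j k : 'I_n) (Y : {set 'S_n}) (c e h :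
  'rV[R]_n).

(* [level_chain c x y]: some maximal chain from [x] to [y] exchanges only positions of
   equal weight. *)
Definition level_step c : rel 'S_n := fun x y => [&& ble x y,
  ninv y == (ninv x).+1 & same_levels c x y].
Definition level_chain c : rel 'S_n := connect (level_step c).

Lemma level_chain_ble c x y : level_chain c x y -> ble x y && same_levels c x y.
Proof.
case/connectP => s; elim: s x => [|z s IHs] x /=; first by move=> _ ->;
  rewrite ble_refl same_levels_refl.
case/andP => /and3P[xz _ cxz] zs e; have /andP[zy czy] := IHs z zs e.
by rewrite (ble_trans xz zy) (same_levels_trans cxz czy).
Qed.

Lemma level_chain_cons c x y : level_chain c x y -> x != y ->
  exists2 z, level_step c x z & level_chain c z y.
Proof.
case/connectP => -[|z s] /=; first by move=> _ ->; rewrite eqxx.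
by case/andP => xz zs e _; exists z => //; apply/connectP; exists s.
Qed.

Lemma const_level_chain c x y : ble x y -> {in bruhat_itv x y, forall z, same_levels c x z} ->
  level_chain c x y.
Proof.
move: x; apply: ble_ind => [_|x p q cov le IHx H]; first exact: connect0.
have xs := cover_ble cov; have cs : same_levels c x (pswap p q x) by apply: H; rewrite inE xs.
apply: connect_trans (connect1 _) (IHx _).
  by rewrite /level_step xs cs (ninv_cover cov) eqxx.
move=> z; rewrite inE => /andP[sz zy]; apply: (@same_levels_trans _ _ _ x);
  first by rewrite same_levels_sym.
by apply: H; rewrite inE zy (ble_trans xs sz).
Qed.

(** The form is invariant under a product of two transpositions, distinct because the length grows;
    [p] and [q] lie in one cycle of this product. *)
Lemma same_levels_rank2 c v w z : same_levels c v w -> ble v z -> ble z w -> ninv z = (ninv v).+1 ->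
  ninv w = (ninv z).+1 -> same_levels c v z.
Proof.
move=> cvw vz zw nz nw; have [p [q [/and3P[pq _ _] ez]]] := ble_cover vz nz.
have [p' [q' [/and3P[pq' _ _] ew]]] := ble_cover zw nw.
rewrite ez; apply: same_levels_pswap.
have H i : c 0 i = c 0 (tperm p' q' (tperm p q i)).
  by have /same_levelsP/(_ (v i)) := cvw; rewrite ew pswap_inv ez pswap_inv permK.
have hp := H p; have hq := H q; rewrite tpermL in hp; rewrite tpermR in hq.
case: tpermP hp => [qp'|qq'|//] hp.
  case: tpermP hq => [pp'|pq2|//] hq; first by rewrite pp' qp' ltnn in pq.
  by rewrite -qp' -pq2 in pq'; have := ltn_trans pq pq'; rewrite ltnn.
case: tpermP hq => [pp'|pq2|//] hq; last by rewrite pq2 qq' ltnn in pq.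
by move: nw; rewrite ew ez -pp' -qq' pswapK -ez nz; nlia.
Qed.

(** By induction, [Q z] below is constant along comparable elements, and it holds for the first atom
    [a] of the given chain; connectedness carries it to every [z]. *)
Lemma level_chain_const c v w : level_chain c v w ->
  {in bruhat_itv v w, forall z, same_levels c v z}.
Proof.
have [d] := ubnP (ninv w - ninv v); elim: d v w => // d IHd v w; rewrite ltnS => hd gvw z.
rewrite inE => /andP[vz zw]; have /andP[vw cvw] := level_chain_ble gvw.
case: (altP (z =P v)) => [->|nzv]; first exact: same_levels_refl.
case: (altP (z =P w)) => [->//|nzw].
have oz : open_itv v w z by rewrite /open_itv vz zw nzv nzw.
have /andP[n1 n2] := open_itv_ninv oz.
case: (ltnP (ninv v + 2) (ninv w)) => d3; last by apply: (same_levels_rank2 cvw vz zw); nlia.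
have nvw : v != w by apply: contraTneq d3 => ->; nlia.
have [a /and3P[va /eqP na ca] gaw] := level_chain_cons gvw nvw.
have /andP[aw _] := level_chain_ble gaw.
have oa : open_itv v w a by apply: open_itvI => //; nlia.
have sub x y x' y' : (ninv y - ninv x < d)%N -> level_chain c x y -> ble x x' -> ble x' y' ->
  ble y' y ->
    level_chain c x' y'.
  move=> lt gxy xx' xy' yy'; apply: const_level_chain => // u; rewrite inE => /andP[a1 a2].
  have H := IHd x y lt gxy; apply: (@same_levels_trans _ _ _ x).
    by rewrite same_levels_sym; apply: H; rewrite inE xx' (ble_trans xy').
  by apply: H; rewrite inE (ble_trans xx') // (ble_trans a2).
pose Q z := level_chain c v z /\ level_chain c z w.
have Qle x y : open_itv v w x -> open_itv v w y -> ble x y -> (Q x <-> Q y).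
  move=> ox oy xy; have /andP[x1 x2] := open_itv_ninv ox; have /andP[y1 y2] := open_itv_ninv oy.
  case/and4P: ox => vx xw _ _; case/and4P: oy => vy yw _ _.
  have ltx : (ninv w - ninv x < d)%N by nlia.
  have lty : (ninv y - ninv v < d)%N by nlia.
  split=> -[Q1 Q2]; split.
  - apply: connect_trans Q1 _; exact: sub ltx Q2 (ble_refl x) xy yw.
  - exact: sub ltx Q2 xy yw (ble_refl w).
  - exact: sub lty Q1 (ble_refl v) vx xy.
  - apply: connect_trans _ Q2; exact: sub lty Q1 vx xy (ble_refl y).
have d3' : (ninv v + 3 <= ninv w)%N by nlia.
have [gvz _] : Q z.
  apply/(open_itv_conn vw d3' Qle oz oa); split=> //.
  by apply: connect1; rewrite /level_step va na eqxx.
by case/andP: (level_chain_ble gvz).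
Qed.

Definition root p q : 'rV[R]_n := delta_mx 0 p - delta_mx 0 q.

Lemma root_ker p q c : (root p q <= kermx c^T)%MS = (c 0 p == c 0 q).
Proof.
rewrite sub_kermx /root mulmxBl -!rowE subr_eq0.
apply/eqP/eqP => [/rowP/(_ 0)|e]; first by rewrite !mxE.
by apply/rowP => i; rewrite !mxE ord1.
Qed.

(** The difference of the two sides is $\langle h,c\rangle$ summed once along [x] and once along
    [y]. *)
Lemma dot_levels c h x y : \sum_k (h 0 (x^-1 k)%g - h 0 (y^-1 k)%g) * c 0 (x^-1 k)%g =
   \sum_k h 0 (y^-1 k)%g * (c 0 (y^-1 k)%g - c 0 (x^-1 k)%g).
Proof.
have e z : \sum_k h 0 (z^-1 k)%g * c 0 (z^-1 k)%g = \sum_k h 0 k * c 0 k.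
  by rewrite [RHS](reindex_inj (@perm_inj _ z^-1%g)).
have : \sum_k h 0 (x^-1 k)%g * c 0 (x^-1 k)%g - \sum_k h 0 (y^-1 k)%g * c 0 (y^-1 k)%g = 0.
  by rewrite !e subrr.
rewrite -sumrB => h0; apply/eqP; rewrite -subr_eq0 -sumrB -[eqbRHS]h0; apply/eqP.
by apply: eq_bigr => k _; ring.
Qed.

(* [S] is spanned by the roots of a maximal chain. The last clause is Carter's lemma:
   a product of reflections in independent roots fixes only the vectors
   orthogonal to all of them. *)
Lemma chain_span x w : ble x w -> exists S : 'M[R]_n,
  [/\ (\rank S <= ninv w - ninv x)%N,
      forall c, (S <= kermx c^T)%MS -> level_chain c x w &
      \rank S = (ninv w - ninv x)%N -> forall c, same_levels c x w -> (S <= kermx c^T)%MS].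
Proof.
move: x; apply: ble_ind => [|x p q cov le [S [rS gS cS]]].
  exists 0; rewrite mxrank0 subnn; split=> // [c _|_ c _]; [exact: connect0 | exact: sub0mx].
have lt := ble_ninv le; have nx := ninv_cover cov.
set x' := pswap p q x in le rS gS cS lt nx *.
have xx' : ble x x' := cover_ble cov.
exists (S + root p q)%MS; split.
- have := mxrank_adds_leqif S (root p q) => -[h _].
  by have := rank_leq_row (root p q); move: h; nlia.
- move=> c; rewrite addsmx_sub root_ker => /andP[Sc /eqP cpq].
  apply: connect_trans (connect1 _) (gS _ Sc).
  by rewrite /level_step xx' nx eqxx same_levels_pswap.
move=> r; have [h _] := mxrank_adds_leqif S (root p q).
have r1 := rank_leq_row (root p q).
have rS' : \rank S = (ninv w - ninv x')%N by move: h r1; nlia.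
have nr : ~~ (root p q <= S)%MS.
  apply/negP => /addsmx_idPl e; move: r; rewrite e; nlia.
move=> c cxw; rewrite addsmx_sub root_ker.
have npq : p != q by case/and3P: cov => pq _ _; rewrite -val_eqE /= neq_ltn pq.
(* Independence of the new root yields a form that kills [S] but not this root. *)
have [h' [Sh hpq]] : exists h', (S <= kermx h'^T)%MS /\ h' 0 p != h' 0 q.
  have [j nj] : exists j, ~~ (root p q <= kermx (col j (cokermx S)))%MS.
    apply/existsP; apply: contraR nr => /existsPn H; rewrite submxE; apply/eqP/rowP => j.
    have := H j; rewrite negbK sub_kermx colE mulmxA -colE => /eqP/colP/(_ 0).
    by rewrite !mxE.
  exists (col j (cokermx S))^T; split.
    by rewrite trmxK sub_kermx colE mulmxA mulmx_coker mul0mx.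
  by rewrite -root_ker trmxK.
(* [h'] is level from [x'] to [w], so between [x] and [w] it changes only at [p] and [q]. Pairing
   with [c] leaves $(h'_p-h'_q)(c_p-c_q)=0$. *)
have cpq : c 0 p = c 0 q.
  have /andP[_ hc] := level_chain_ble (gS _ Sh).
  have := dot_levels c h' x w; rewrite [RHS]big1 => [|k _]; last first.
    by have /same_levelsP/(_ k) -> := cxw; rewrite subrr mulr0.
  rewrite (reindex_inj (@perm_inj _ x)) /= (sumr_split2 _ npq) big1 => [|i /andP[ip iq]].
    have E i : h' 0 (w^-1 (x i))%g = h' 0 (tperm p q i).
      by have /same_levelsP/(_ (x i)) <- := hc; rewrite pswap_inv permK.
    rewrite !E !permK tpermL tpermR addr0 => e.
    have : (h' 0 p - h' 0 q) * (c 0 p - c 0 q) = 0 by rewrite -[RHS]e; ring.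
    by move/eqP; rewrite mulf_eq0 !subr_eq0 (negbTE hpq) => /eqP.
  have /same_levelsP/(_ (x i)) <- := hc; rewrite pswap_inv permK tpermD 1?eq_sym // subrr mul0r //.
rewrite cpq eqxx andbT; apply: cS => //.
by apply: same_levels_trans cxw; rewrite same_levels_sym; apply: same_levels_pswap.
Qed.

(** The kernel of [pdiff] lies in the annihilator of [S], which bounds its rank from below by that
    of [S]. *)
Lemma chain_toric_rank v w (S : 'M[R]_n) : ble v w -> (ninv w - ninv v <= \rank S)%N ->
  (forall c, same_levels c v w -> (S <= kermx c^T)%MS) -> toric_rank R v w.
Proof.
move=> vw rS cS; rewrite /toric_rank vw eqn_leq rank_pdiff_le //=; apply: leq_trans rS _.
have : (kermx (pdiff R v w) <= kermx S^T)%MS.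
  apply/row_subP => i; have := cS (row i (kermx (pdiff R v w))).
  rewrite same_levels_pdiff -row_mul mulmx_ker row0 eqxx => /(_ isT).
  rewrite !sub_kermx => /eqP/(congr1 trmx); rewrite trmx_mul trmxK trmx0 => ->.
  exact: eqxx.
move/mxrankS; rewrite !mxrank_ker mxrank_tr.
have := rank_leq_row (pdiff R v w); have := rank_leq_row S; lia.
Qed.

End Chains.

(** * Bruhat interval polytopes *)

Section Polytope.
Variables (R : realType) (n : nat).
Implicit Types (x y z v w : 'S_n) (p q : 'rV[R]_n) (S T : {set 'S_n}) (c h : 'rV[R]_n).

Definition dot c (p : 'rV[R]_n) : R := \sum_i c 0 i * p 0 i.

Lemma dot_linear c : scalar (dot c).
Proof.
move=> a p q; rewrite /dot mulr_sumr -big_split; apply: eq_bigr => i _.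
by rewrite !mxE /=; ring.
Qed.

HB.instance Definition _ c := GRing.isLinear.Build R 'rV[R]_n R *%R (dot c) (@dot_linear c).

Lemma scalar_dot (f : {scalar 'rV[R]_n}) : f =1 dot (\row_i f (delta_mx 0 i)).
Proof.
move=> p; rewrite {1}[p]row_sum_delta linear_sum; apply: eq_bigr => i _.
by rewrite linearZ mxE mulrC.
Qed.

Lemma dot_point c z : dot c (perm_point R z) = lval c z + \sum_i c 0 i.
Proof.
rewrite /dot /lval -big_split; apply: eq_bigr => i _.
by rewrite mxE -natr1 mulrDr mulr1.
Qed.

Definition hull S : set 'rV[R]_n := convex_hull [set perm_point R z | z in [set` S]]%classic.

Lemma polytopeE v w : bruhat_interval_polytope R v w = hull (bruhat_itv v w).
Proof.
congr (convex_hull _); apply/seteqP; split=> _ [z zvw <-]; exists z => //.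
  by move: zvw; rewrite /= !bruhat_leE inE.
by move: zvw; rewrite /= !bruhat_leE inE.
Qed.

Lemma hull_point S z : z \in S -> hull S (perm_point R z).
Proof.
move=> zS; exists 1%N, (fun=> 1), (fun=> perm_point R z); split=> //.
- by move=> _; exists z.
- by rewrite big_ord1.
- by rewrite big_ord1 scale1r.
Qed.

Lemma hull_sub S T : S \subset T -> (hull S `<=` hull T)%classic.
Proof.
move=> ST _ [k [a [p [pS a0 a1 ->]]]]; exists k, a, p; split=> // i.
by have [z zS <-] := pS i; exists z => //; exact: (subsetP ST z zS).
Qed.

Lemma dot_comb c (k : nat) (a : 'I_k -> R) (p : 'I_k -> 'rV[R]_n) :
  dot c (\sum_i a i *: p i) = \sum_i a i * dot c (p i).
Proof. by rewrite linear_sum; apply: eq_bigr => i _; rewrite linearZ. Qed.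

Lemma affine_const c S b : (forall z, z \in S -> dot c (perm_point R z) = b) ->
  forall p, affine_hull (hull S) p -> dot c p = b.
Proof.
move=> H _ [k [a [p [pS a1 ->]]]]; rewrite dot_comb.
rewrite (eq_bigr (fun i => a i * b)) -?mulr_suml ?a1 ?mul1r // => i _.
congr (_ * _); have [l [a' [p' [pS' _ a1' ->]]]] := pS i; rewrite dot_comb.
rewrite (eq_bigr (fun i => a' i * b)) -?mulr_suml ?a1' ?mul1r // => j _.
by congr (_ * _); have [z zS <-] := pS' j; exact: H.
Qed.

Lemma toric_toric_rank v w : bruhat_le v w -> toric R v w -> toric_rank R v w.
Proof.
rewrite bruhat_leE => vw; rewrite /toric !perm_lengthE polytopeE => -[x0 [U [aU dU]]].
have [S [rS gS cS]] := chain_span R vw.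
have US u : u \in U -> (u <= S)%MS.
  move=> uU; rewrite submxE; apply/eqP/rowP => j.
  (* The columns of the cokernel are forms that cut out the span of [S]. Each is level along the
     chain, hence constant on the interval and on its affine hull, so it kills every direction
     [u]. *)
  pose h := (col j (cokermx S))^T.
  have Sh : (S <= kermx h^T)%MS by rewrite trmxK sub_kermx colE mulmxA mulmx_coker mul0mx.
  have hE p : dot h p = (p *m cokermx S) 0 j.
    by rewrite /dot mxE; apply: eq_bigr => i _; rewrite !mxE mulrC.
  rewrite -hE mxE.
  have H z : z \in bruhat_itv v w -> dot h (perm_point R z) = lval h v + \sum_i h 0 i.
    by move=> zvw; rewrite dot_point -(same_levels_lval (level_chain_const (gS _ Sh) zvw)).
  have in0 : affine_hull (hull (bruhat_itv v w)) x0 by rewrite aU /= subrr mem0v.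
  have inu : affine_hull (hull (bruhat_itv v w)) (u + x0) by rewrite aU /= addrK.
  have e : dot h (u + x0) = dot h u + dot h x0 by exact: linearD.
  move: e; rewrite (affine_const H inu) (affine_const H in0) => /eqP.
  by rewrite eq_sym -subr_eq0 addrK => /eqP.
have dS : (\dim U <= \rank S)%N.
  pose M := \matrix_(i < \dim U) (vbasis U)`_i.
  have MS : (M <= S)%MS.
    by apply/row_subP => i; rewrite rowK; apply: US; apply: vbasis_mem;
      rewrite mem_nth // size_tuple.
  apply: leq_trans (mxrankS MS); rewrite -[X in (X <= _)%N](_ : \rank M = _) //.
  apply/eqP; rewrite -/(row_free M) -kermx_eq0; apply/rowV0P => a /sub_kermxP aM.
  have /freeP fr := basis_free (vbasisP U).
  apply/rowP => i; rewrite mxE; apply: (fr (fun i => a 0 i)).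
  by rewrite -[RHS]aM mulmx_sum_row; apply: eq_bigr => k _; rewrite rowK.
rewrite dU in dS; apply: (chain_toric_rank vw dS); apply: cS; apply/eqP.
by rewrite eqn_leq rS.
Qed.

Definition level_set c (b : R) S := [set z in S | dot c (perm_point R z) == b].

Lemma face_hull c b S : (forall z, z \in S -> dot c (perm_point R z) <= b) ->
  (forall p, hull S p -> dot c p <= b) /\
  (hull S `&` [set p | dot c p = b] = hull (level_set c b S))%classic.
Proof.
move=> le; split.
  move=> _ [k [a [p [pS a0 a1 ->]]]]; rewrite dot_comb -[b]mul1r -a1 mulr_suml.
  apply: ler_sum => i _; apply: ler_wpM2l => //; have [z zS <-] := pS i; exact: le.
apply/seteqP; split; last first.
  move=> _ [k [a [p [pS a0 a1 ->]]]]; split.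
    by exists k, a, p; split=> // i; have [z + <-] := pS i; rewrite /= inE => /andP[zS _]; exists z.
  rewrite /= dot_comb -[RHS]mul1r -a1 mulr_suml; apply: eq_bigr => i _.
  by have [z + <-] := pS i; rewrite /= inE => /andP[_ /eqP ->].
move=> _ [[k [a [p [pS a0 a1 ->]]]]]; rewrite /= dot_comb => eb.
have pb i : dot c (p i) <= b by have [z zS <-] := pS i; exact: le.
have zero i : a i * (b - dot c (p i)) = 0.
  have : \sum_i a i * (b - dot c (p i)) = 0.
    rewrite (eq_bigr (fun i => a i * b - a i * dot c (p i))) => [|j _]; last by rewrite mulrBr.
    by rewrite sumrB -mulr_suml a1 mul1r eb subrr.
  move/eqP; rewrite psumr_eq0 => [/allP/(_ i)|j _]; last by rewrite mulr_ge0 // subr_ge0.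
  by rewrite mem_index_enum => /(_ isT)/eqP.
have [i0 ai0] : exists i, a i != 0.
  apply/existsP; apply: contraT => /existsPn H; move: a1; rewrite big1 => [/eqP|i _].
    by rewrite eq_sym oner_eq0.
  by apply/eqP; move: (H i); rewrite negbK.
have good i : a i != 0 -> dot c (p i) = b.
  move=> ai; have /eqP := zero i; rewrite mulf_eq0 (negbTE ai) subr_eq0 => /eqP <- //.
(* Points of weight zero may lie off the hyperplane and are replaced by one of nonzero weight. *)
exists k, a, (fun i => if a i == 0 then p i0 else p i); split=> //.
  move=> i; have [z zS ez] := pS (if a i == 0 then i0 else i).
  exists z; last by rewrite ez; case: ifP.
  rewrite /= inE ez; apply/andP; split=> //; apply/eqP/good.
  by case: (altP (a i =P 0)).
by apply: eq_bigr => i _; case: eqP => // ->; rewrite !scale0r.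
Qed.

Definition is_face S T := exists c b, (forall z, z \in S -> dot c (perm_point R z) <= b) /\
  T = level_set c b S.

Lemma facesP S (P : set 'rV[R]_n) : faces (hull S) P <-> exists2 T, is_face S T & P = hull T.
Proof.
split=> [[f [b [fb ->]]]|[_ [c [b [le ->]]] ->]].
  set c := \row_i f (delta_mx 0 i).
  have le z : z \in S -> dot c (perm_point R z) <= b.
    by move=> zS; rewrite -scalar_dot; apply: fb; exact: hull_point.
  exists (level_set c b S); first by exists c, b.
  have [_ <-] := face_hull le; apply/seteqP; split=> p [pS e]; split=> //.
    by rewrite /= -scalar_dot.
  by rewrite /= scalar_dot.
by have [fb e] := face_hull le; exists (dot c), b.
Qed.

Lemma face_vertex S T z : is_face S T -> z \in S -> hull T (perm_point R z) -> z \in T.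
Proof.
case=> c [b [le ->]] zS; have [_ <-] := face_hull le => -[_ /= e].
by rewrite inE zS e eqxx.
Qed.

Lemma face_subset S T : is_face S T -> T \subset S.
Proof. by case=> c [b [_ ->]]; apply/subsetP => z; rewrite inE => /andP[]. Qed.

(** A face is cut out by a hyperplane, so a point of [S] lying in its hull already belongs to its
    vertex set. *)
Lemma hull_le S T T' : is_face S T -> is_face S T' ->
  (hull T `<=` hull T')%classic <-> T \subset T'.
Proof.
move=> fT fT'; split=> [H|]; last exact: hull_sub.
apply/subsetP => z zT; apply: (face_vertex fT'); first exact: (subsetP (face_subset fT)).
by apply: H; exact: hull_point.
Qed.

Lemma toric_rank_is_face v w T : toric_rank R v w ->
  is_face (bruhat_itv v w) T <-> T = set0 \/ exists x y, [/\ ble v x, ble x y,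
    ble y w & T = bruhat_itv x y].
Proof.
move=> tvw; split=> [[c [b [le ->]]]|].
  case: (set_0Vmem (level_set c b (bruhat_itv v w))) => [->|[z0 z0L]]; [by left | right].
  have [x [y [vx xy yw M]]] := toric_rank_maxset c tvw.
  exists x, y; split=> //; rewrite -M; apply/setP => z.
  have [z0S /eqP z0b] : z0 \in bruhat_itv v w /\ dot c (perm_point R z0) == b.
    by apply/andP; move: z0L; rewrite inE.
  have z0M : z0 \in maxset c (bruhat_itv v w).
    rewrite inE z0S; apply/forall_inP => y' /le.
    by rewrite -z0b !dot_point lerD2r.
  rewrite [LHS]inE; case: (boolP (z \in bruhat_itv v w)) => zS; last by rewrite inE (negbTE zS).
  by rewrite (maxset_eq z0M zS) eq_le le //= -z0b !dot_point lerD2r.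
case=> [->|[x [y [vx xy yw ->]]]].
  (* The zero form with bound 1 exposes the empty face. *)
  exists 0, 1; split=> [z _|]; rewrite /level_set ?dot_point /dot.
    by rewrite /lval !big1 ?addr0 ?ler01 // => i _; rewrite !mxE ?mul0r.
  apply/esym/setP => z; rewrite !inE big1 => [|i _]; last by rewrite !mxE mul0r.
  by rewrite eq_sym oner_eq0 andbF.
have [_ /(_ x y vx xy yw)[c M]] := toric_rank_faces tvw.
have xM : x \in maxset c (bruhat_itv v w) by rewrite M bruhat_itvL.
exists c, (dot c (perm_point R x)); split=> [z zS|].
  by rewrite !dot_point lerD2r (maxset_le xM).
apply/setP => z; rewrite -M [in RHS]inE; case: (boolP (z \in bruhat_itv v w)) => zS; last first.
  by rewrite inE (negbTE zS).
rewrite (maxset_eq xM zS) !dot_point eq_le !lerD2r (maxset_le xM) //.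
Qed.

Lemma toric_rank_inv v w : toric_rank R v w -> toric_rank R v^-1%g w^-1%g.
Proof.
case/andP=> vw /eqP r; rewrite /toric_rank ble_inv vw !ninv_inv -r /pdiff -!tr_perm_mx.
by rewrite -linearB mxrank_tr /=.
Qed.

Definition inv_set T : {set 'S_n} := [set z | (z^-1)%g \in T].

Lemma inv_setK : involutive inv_set.
Proof. by move=> T; apply/setP => z; rewrite !inE invgK. Qed.

Lemma inv_bruhat_itv x y : inv_set (bruhat_itv x y) = bruhat_itv x^-1%g y^-1%g.
Proof. by apply/setP => z; rewrite !inE -[z in RHS]invgK !ble_inv. Qed.

Lemma inv_sub T T' : (inv_set T \subset inv_set T') = (T \subset T').
Proof.
apply/subsetP/subsetP => H z zT; last by move: zT; rewrite !inE; exact: H.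
by have := H z^-1%g; rewrite !inE invgK; apply.
Qed.

Lemma is_face_inv v w T : toric_rank R v w -> is_face (bruhat_itv v w) T ->
  is_face (bruhat_itv v^-1%g w^-1%g) (inv_set T).
Proof.
move=> tvw /(toric_rank_is_face _ tvw) fT; apply/(toric_rank_is_face _ (toric_rank_inv tvw)).
case: fT => [->|[x [y [vx xy yw ->]]]]; [left | right].
  by apply/setP => z; rewrite !inE.
by exists x^-1%g, y^-1%g; rewrite !ble_inv inv_bruhat_itv.
Qed.

End Polytope.

Arguments hull R {n} S _.

Theorem corollary5p3 (R : realType) (n : nat) (v w : 'S_n) :
  bruhat_le v w ->
  toric R v w ->
  combinatorially_equivalent
    (bruhat_interval_polytope R v w)
    (bruhat_interval_polytope R (v^-1)%g (w^-1)%g).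
Proof.
move=> vw /(toric_toric_rank vw) tvw; rewrite !polytopeE.
have tvw' := toric_rank_inv tvw.
(* The isomorphism passes through vertex sets, on which inversion acts; its injectivity follows
   because it reflects inclusion. *)
pose vert (P : set 'rV[R]_n) : {set 'S_n} := [set z in bruhat_itv v w | `[< P (perm_point R z) >]].
have vertE T : is_face R (bruhat_itv v w) T -> vert (hull R T) = T.
  move=> fT; apply/setP => z; rewrite inE; apply/andP/idP => [[zS /asboolP]|zT].
    exact: face_vertex fT zS.
  by split; [exact: (subsetP (face_subset fT)) | apply/asboolP; exact: hull_point].
exists (fun P => hull R (inv_set (vert P))).
have le (P Q : set 'rV[R]_n) : faces (hull R (bruhat_itv v w)) P ->
  faces (hull R (bruhat_itv v w)) Q ->
    (hull R (inv_set (vert P)) `<=` hull R (inv_set (vert Q)) <-> P `<=` Q)%classic.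
  move=> /facesP[T fT ->] /facesP[T' fT' ->]; rewrite !vertE //.
  have [] := hull_le (is_face_inv tvw fT) (is_face_inv tvw fT'); rewrite inv_sub => a b.
  have [a' b'] := hull_le fT fT'.
  by split=> H; [exact: (b' (a H)) | exact: (b (a' H))].
split=> //; split.
- move=> P /facesP[T fT ->]; apply/facesP; rewrite vertE //.
  by exists (inv_set T) => //; exact: is_face_inv.
- move=> P Q /set_mem fP /set_mem fQ e; apply/seteqP; split.
    by apply/(le P Q) => //; rewrite e.
  by apply/(le Q P) => //; rewrite e.
move=> _ /facesP[T fT ->].
have fT' : is_face R (bruhat_itv v w) (inv_set T).
  by have := is_face_inv tvw' fT; rewrite !invgK.
exists (hull R (inv_set T)); first by apply/facesP; exists (inv_set T).
by rewrite vertE // inv_setK.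
Qed.
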